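(* Let $\alpha\in(1,2)$ and consider the PARID model with parameters $\delta=0$ and $X$, where $X$ has the power-law distribution $\mathbb{P}[X=i]=\beta(\alpha)\, i^{-\alpha}$, $i\in\{1,2,\dots\}$. For $k\ge 1$ let $r_k(t)$ be the proportion of vertices of degree $k$ after step $t$. Then for any fixed integer $k\ge 1$ there exists no constant $a\in[0,1]$ such that $r_k(t)\to a$ in probability as $t\to\infty$.
   Context: $\beta(\alpha)=\bigl(\sum_{i\ge1} i^{-\alpha}\bigr)^{-1}$ is the normalising constant. PARID model (Preferential Attachment with Random Initial Degrees) with $\delta=0$ and a positive-integer-valued random variable $X$: let $X_1,X_2,\dots$ be independent copies of $X$ and $\Lambda(t)=\sum_{i=1}^t X_i$. In step $1$ two vertices $v_0,v_1$ are created and joined by $X_1$ (parallel) edges. In each step $t\ge 2$ a new vertex $v_t$ is added together with $X_t$ edges; each of these $X_t$ edges is generated independently (given the multigraph after step $t-1$ and $X_t$) by choosing a vertex $v_i$, $0\le i\le t-1$, with probability $\frac{d_i(t-1)}{2\Lambda(t-1)}$, where $d_i(t-1)$ is the degree of $v_i$ after step $t-1$, and adding the edge $\{v_i,v_t\}$ to the multigraph. (Edges added in the same step do not influence each other's selection probabilities, and there are no loops.) $R_k(t)$ is the number of vertices of degree $k$ after step $t$, and $r_k(t)=R_k(t)/(t+1)$. *)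

(* Defs.v *)
From HB Require Import structures.
From mathcomp Require Import all_boot all_order all_algebra.
From mathcomp Require Import all_classical all_reals all_analysis.

Set Implicit Arguments.
Unset Strict Implicit.
Unset Printing Implicit Defensive.
Import Order.TTheory GRing.Theory Num.Theory.
Import numFieldNormedType.Exports.

Local Open Scope classical_set_scope.
Local Open Scope ring_scope.

(** A loopless multigraph on v_0, ..., v_(n-1) is encoded by its adjacency
    matrix [A : 'M[nat]_n]: [A i j] is the number of parallel edges {v_i, v_j}. *)

Definition degree (n : nat) (A : 'M[nat]_n) (i : 'I_n) : nat :=
  (\sum_j A i j)%N.

(* [ord_max] is the new vertex; its l-th edge (l < m) goes to vertex [c l].
   Only the values [c l < n] matter: others never occur in the model, except
   on a null event. *)
Definition attach (n : nat) (A : 'M[nat]_n) (m : nat) (c : nat -> nat) :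
    'M[nat]_n.+1 :=
  \matrix_(i, j)
    match unlift ord_max i, unlift ord_max j with
    | Some i', Some j' => A i' j'
    | Some v, None | None, Some v => #|[pred l : 'I_m | c l == v :> nat]|
    | None, None => 0%N
    end.

(* The multigraph after step t, where [x s] is the number of edges added in
   step s and [c s l] the index of the vertex chosen by the l-th of them. There
   is no choice in step 1: all [x 1] edges join v_1 to v_0. *)
Fixpoint graph (x : nat -> nat) (c : nat -> nat -> nat) (t : nat) :
    'M[nat]_t.+1 :=
  match t with
  | 0 => const_mx 0%N
  | s.+1 => attach (graph x c s) (x s.+1)
                   (if s is 0 then fun=> 0%N else c s.+1)
  end.

Definition Lambda (x : nat -> nat) (t : nat) : nat :=
  (\sum_(1 <= i < t.+1) x i)%N.

Definition num_degree (n : nat) (A : 'M[nat]_n) (k : nat) : nat :=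
  #|[pred i | degree A i == k]|.

Section Probability.
Context d (T : measurableType d) (R : realType) (P : probability T R).

Definition mutually_independent (I : eqType) (D : {pred I})
    (X : I -> {RV P >-> nat}) : Prop :=
  forall (s : seq I) (A : I -> set nat), uniq s -> {subset s <= D} ->
    P (\big[setI/setT]_(i <- s) (X i @^-1` A i)) =
    (\prod_(i <- s) P (X i @^-1` A i))%E.

Definition cvg_in_probability (Y : nat -> T -> R) (a : R) : Prop :=
  forall eps : R, 0 < eps ->
    P [set w | eps <= `|Y t w - a|] @[t --> \oo] --> 0%E.

Variables (X : nat -> {RV P >-> nat}) (C : nat -> nat -> {RV P >-> nat}).

Definition rgraph (t : nat) (w : T) : 'M[nat]_t.+1 :=
  graph (X ^~ w) (fun s l => C s l w) t.

Definition rLambda (t : nat) (w : T) : nat := Lambda (X ^~ w) t.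

Definition R_ (k t : nat) (w : T) : nat := num_degree (rgraph t w) k.

Definition r_ (k t : nat) (w : T) : R := (R_ k t w)%:R / t.+1%:R.

(** The PARID model with delta = 0 and initial degree variable [X0] (possibly
    on another probability space): [X t] is the number of edges added in step
    [t >= 1], and [C t l], for [t >= 2] and [l < X t], is the index of the
    vertex chosen by the l-th of them. The conditional laws, being conditional
    on discrete variables, are written in product form, which makes them void
    when the conditioning event is null. *)
Record PARID d' (T' : measurableType d') (Q : probability T' R)
    (X0 : {RV Q >-> nat}) : Prop := {
  PARID_copies : forall (t : nat) (A : set nat), (1 <= t)%N ->
    distribution P (X t) A = distribution Q X0 A;
  PARID_indep : mutually_independent [pred t | (1 <= t)%N] X;
  (* the edge choices made up to step t give no information on X_(t+1) *)
  PARID_fresh : forall (t : nat) (g : 'M[nat]_t.+1) (m : nat), (1 <= t)%N ->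
    P ([set w | rgraph t w = g] `&` [set w | X t.+1 w = m]) =
    (P [set w | rgraph t w = g] * P [set w | X t.+1 w = m])%E;
  (* given the multigraph after step t and X_(t+1) = m, the m choices of step
     t+1 are independent, v_i being chosen with probability
     d_i(t) / (2 Lambda(t)) *)
  PARID_choice : forall (t : nat) (g : 'M[nat]_t.+1) (L m : nat)
      (c : 'I_m -> 'I_t.+1), (1 <= t)%N ->
    let past := [set w | [/\ rgraph t w = g, rLambda t w = L
                           & X t.+1 w = m]] in
    P (past `&` [set w | forall l : 'I_m, C t.+1 l w = c l]) =
    (P past * (\prod_(l < m) ((degree g (c l))%:R / (2 * L)%:R))%:E)%E
}.

End Probability.

Definition beta (R : realType) (alpha : R) : R :=
  (\big[+%R/0]_(1 <= i <oo) i%:R `^ (- alpha))^-1.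

(* Main.v *)
Require Import Defs.
From mathcomp Require Import all_boot all_order all_algebra.
From mathcomp Require Import all_classical all_reals all_analysis.
From mathcomp Require Import measurable_realfun ring lra zify.
Import Order.TTheory GRing.Theory Num.Theory.
Import numFieldNormedType.Exports.
Local Open Scope classical_set_scope.
Local Open Scope ring_scope.

(** Why [r_k] does not converge. The mean of [X] is infinite: sums of copies of
    [X] are governed by their largest term, which is comparable with the sum of
    all others and can be much larger, with a probability that does not vanish.
    The degree sequence feels such a jump, and it feels it differently according
    to when the jump occurs.

    The tail [tail L] of the power law and its truncated mean at [L] satisfy
    two estimates, [tail_scale] and [truncated_mean_le]. For [N] of the order
    [1 / tail L], as in [critical_scale], they make both of the following events
    have probability bounded away from 0, for every fixed factor [m]: one of the
    first [N] steps (or of a fixed fraction of them) brings more than [m * L]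
    edges, and all the other steps together bring at most [L] edges.

    A late jump empties the small degrees. Each of the [m * L] edges of the jump
    hits any given older vertex with probability at least [1 / (2 * L)], so that
    the older vertices all get many new edges if [m] is large
    ([pr_small_degree]), while the vertices that come after the jump are a small
    fraction. So [r_k] is small with a probability that does not vanish, and its
    limit cannot be positive ([not_cvg_pos]).

    An early jump protects the newcomers. After a jump of size [m * L] in the
    first half, a vertex that comes with [k] edges in the second half is hit by
    an edge with probability at most [k / (2 * m * L)], and there are at most
    [L] edges to come ([pr_touched]). It therefore keeps degree [k] with
    large conditional probability, the mean of [r_k] is bounded from below, and
    its limit cannot be 0 ([not_cvg0]).

    Both arguments look at one step at a time, given the state before it. The
    state enters through degrees and the total number of edges; that the degrees
    sum up to [2 * Lambda] is an almost sure statement, because the choice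
    variables are arbitrary on a null event ([pr_proper]). *)

Set Implicit Arguments.
Unset Strict Implicit.
Unset Printing Implicit Defensive.

(** * Real-valued probabilities and double counting *)

Section RealProbability.
Context d (T : measurableType d) (R : realType) (P : probability T R).

Definition pr (A : set T) : R := fine (P A).

Lemma prE (A : set T) : measurable A -> P A = (pr A)%:E.
Proof. by move=> mA; rewrite /pr fineK// fin_num_measure. Qed.

Lemma pr_ge0 (A : set T) : 0 <= pr A.
Proof. exact: fine_ge0. Qed.

Lemma prT : pr setT = 1.
Proof. by rewrite /pr probability_setT. Qed.

Lemma pr0 : pr set0 = 0.
Proof. by rewrite /pr measure0. Qed.

Lemma integral_weighted_indic (I : Type) (r : seq I) (c : I -> R)
    (D : I -> set T) :
  (forall i, 0 <= c i) -> (forall i, measurable (D i)) ->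
  (\int[P]_x (\sum_(i <- r) c i * \1_(D i) x)%:E)%E =
  (\sum_(i <- r) c i * pr (D i))%:E.
Proof.
move=> c0 mD.
have mI i : measurable_fun setT (EFin \o (\1_(D i) : T -> R)).
  exact/measurable_EFinP/measurable_indic.
under eq_integral do rewrite -sumEFin.
rewrite ge0_integral_sum//; last 2 first.
- by move=> i; apply/measurable_EFinP; apply: measurable_funM.
- by move=> i x _; rewrite lee_fin mulr_ge0.
rewrite -sumEFin; apply: eq_bigr => i _.
under eq_integral do rewrite EFinM.
rewrite ge0_integralZl_EFin//; last exact: mI.
by rewrite integral_indic// setIT [RHS]EFinM -prE.
Qed.

(** All the finite estimates of probabilities below (union bounds, additivity,
    Markov's inequality, first moments) are instances of this one: a pointwise
    inequality between two counting functions is preserved by expectation. *)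
Lemma pr_weighted_le (I J : Type) (r : seq I) (s : seq J)
    (c : I -> R) (e : J -> R) (D : I -> set T) (E : J -> set T) :
  (forall i, 0 <= c i) -> (forall j, 0 <= e j) ->
  (forall i, measurable (D i)) -> (forall j, measurable (E j)) ->
  (forall x, \sum_(i <- r) c i * \1_(D i) x <= \sum_(j <- s) e j * \1_(E j) x) ->
  \sum_(i <- r) c i * pr (D i) <= \sum_(j <- s) e j * pr (E j).
Proof.
move=> c0 e0 mD mE le_DE.
rewrite -lee_fin -!integral_weighted_indic//.
have mS K (q : seq K) (g : K -> R) (G : K -> set T) :
    (forall i, measurable (G i)) ->
    measurable_fun setT (EFin \o (fun x => \sum_(i <- q) g i * \1_(G i) x)).
  move=> mG; apply/measurable_EFinP.
  by apply: measurable_sum => i; apply: measurable_funM.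
apply: ge0_le_integral => //; do ?exact: mS.
- by move=> x _; rewrite lee_fin sumr_ge0// => i _; rewrite mulr_ge0.
- by move=> x _; rewrite lee_fin.
Qed.

Lemma pr_count_le (I J : Type) (r : seq I) (s : seq J)
    (D : I -> set T) (E : J -> set T) :
  (forall i, measurable (D i)) -> (forall j, measurable (E j)) ->
  (forall x, \sum_(i <- r) (\1_(D i) x : R) <= \sum_(j <- s) \1_(E j) x) ->
  \sum_(i <- r) pr (D i) <= \sum_(j <- s) pr (E j).
Proof.
move=> mD mE le_DE.
have one K (q : seq K) (F : K -> R) : \sum_(i <- q) 1 * F i = \sum_(i <- q) F i.
  by apply: eq_bigr => i _; rewrite mul1r.
rewrite -(one _ r) -(one _ s); apply: pr_weighted_le => // x; rewrite !one.
exact: le_DE.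
Qed.

Lemma pr_mono (A B : set T) : measurable A -> measurable B -> A `<=` B ->
  pr A <= pr B.
Proof.
move=> mA mB AB; rewrite -lee_fin -!prE//.
by apply: le_measure => //; rewrite inE.
Qed.

Lemma pr_cover (I : eqType) (r : seq I) (A : set T) (D : I -> set T) :
  measurable A -> (forall i, measurable (D i)) ->
  (forall x, A x -> exists2 i, i \in r & D i x) ->
  pr A <= \sum_(i <- r) pr (D i).
Proof.
move=> mA mD cov.
have := @pr_count_le unit I [:: tt] r (fun=> A) D.
rewrite big_seq1; apply=> // x; rewrite big_seq1 indicE.
have [|_] := boolP (x \in A); last by rewrite sumr_ge0.
rewrite inE => /cov[i ir Dix].
by rewrite (big_rem i)//= indicE mem_set// lerDl sumr_ge0.
Qed.

Lemma pr_le2 (A B C : set T) : measurable A -> measurable B -> measurable C ->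
  A `<=` B `|` C -> pr A <= pr B + pr C.
Proof.
move=> mA mB mC ABC.
have := @pr_cover bool [:: true; false] A (fun b => if b then B else C).
rewrite big_cons big_seq1; apply=> //; first by case.
by move=> x /ABC[]; [exists true|exists false].
Qed.

Lemma pr_disjoint (I : eqType) (r : seq I) (D : I -> set T) (B : set T) :
  uniq r -> (forall i, measurable (D i)) -> measurable B ->
  (forall i x, i \in r -> D i x -> B x) ->
  (forall i j x, i \in r -> j \in r -> D i x -> D j x -> i = j) ->
  \sum_(i <- r) pr (D i) <= pr B.
Proof.
move=> ur mD mB DB dj.
have := @pr_count_le I unit r [:: tt] D (fun=> B).
rewrite big_seq1; apply=> // x; rewrite big_seq1.
have [/hasP[i ir Dix]|/hasPn nD] := boolP (has (fun i => x \in D i) r).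
  have Dx : D i x by rewrite inE in Dix.
  rewrite (big_rem i)//= big_seq big1 ?addr0.
    by rewrite !indicE !mem_set//; apply: DB Dx.
  move=> j; rewrite mem_rem_uniq// !inE => /andP[/eqP ji jr].
  rewrite indicE memNset// => Djx; apply: ji; exact: dj Djx Dx.
rewrite big_seq big1// => i ir; rewrite indicE.
by rewrite (negbTE (nD _ ir)).
Qed.

Lemma pr_partition (I : eqType) (r : seq I) (D : I -> set T) (B : set T) :
  uniq r -> (forall i, measurable (D i)) -> measurable B ->
  (forall x, B x <-> exists2 i, i \in r & D i x) ->
  (forall i j x, i \in r -> j \in r -> D i x -> D j x -> i = j) ->
  pr B = \sum_(i <- r) pr (D i).
Proof.
move=> ur mD mB BD dj; apply/eqP; rewrite eq_le pr_cover//=; last first.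
  by move=> x /BD.
by apply: pr_disjoint => // i x ir Dx; apply/BD; exists i.
Qed.

Lemma pr_setD (A B : set T) : measurable A -> measurable B ->
  pr A = pr (A `&` B) + pr (A `&` ~` B).
Proof.
move=> mA mB.
rewrite (@pr_partition bool [:: true; false]
  (fun b => if b then A `&` B else A `&` ~` B) A) ?big_cons ?big_nil ?addr0//.
- by case; apply: measurableI => //; exact: measurableC.
- move=> x; split=> [Ax|[[] _ []//]].
  by case: (pselect (B x)) => Bx; [exists true|exists false].
- by case; case=> // x _ _ [_ ?] [_ ?].
Qed.

Lemma pr_markov (I : eqType) (r : seq I) (c : I -> R) (D : I -> set T)
    (b : R) (H : set T) :
  0 <= b -> (forall i, 0 <= c i) -> (forall i, measurable (D i)) ->
  measurable H ->
  (forall x, H x -> b <= \sum_(i <- r) c i * \1_(D i) x) ->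
  b * pr H <= \sum_(i <- r) c i * pr (D i).
Proof.
move=> b0 c0 mD mH bD.
have := @pr_weighted_le unit I [:: tt] r (fun=> b) c (fun=> H) D.
rewrite big_seq1; apply => // x.
rewrite big_seq1 indicE; have [|_] := boolP (x \in H).
  by rewrite inE mulr1 => /bD.
by rewrite mulr0 sumr_ge0// => i _; rewrite mulr_ge0.
Qed.

End RealProbability.

(** * Discrete random variables *)

Section Discrete.
Context d (T : measurableType d) (R : realType) (P : probability T R).
Local Notation pr := (pr P).

(** Multigraphs carry no sigma-algebra, so that measurability of a variable with
    values in a countable type is expressed by its fibres. *)
Definition discrete (U : Type) (f : T -> U) : Prop :=
  forall u, measurable (f @^-1` [set u]).

Lemma discrete_event (U : countType) (f : T -> U) (S : U -> Prop) :
  discrete f -> measurable [set w | S (f w)].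
Proof.
move=> mf.
have -> : [set w | S (f w)] =
    \bigcup_u (if pselect (S u) then f @^-1` [set u] else set0).
  apply/seteqP; split=> w /=.
    by move=> Sfw; exists (f w) => //; case: pselect.
  by case=> u _; case: (pselect (S u)) => Su /= => [->|[]].
apply: countable_bigcupT_measurable; first exact: countableP.
by move=> u; case: (pselect (S u)) => Su; [exact: mf|exact: measurable0].
Qed.

Lemma discrete_comp (U : countType) (V : Type) (h : U -> V) (f : T -> U) :
  discrete f -> discrete (fun w => h (f w)).
Proof. by move=> mf v; exact: (@discrete_event U f (fun u => h u = v)). Qed.

Lemma discrete_pair (U V : Type) (f : T -> U) (g : T -> V) :
  discrete f -> discrete g -> discrete (fun w => (f w, g w)).
Proof.
move=> mf mg [u v].
have -> : (fun w => (f w, g w)) @^-1` [set (u, v)] =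
    f @^-1` [set u] `&` g @^-1` [set v].
  by apply/seteqP; split=> w /=; [case=> -> ->|case=> -> ->].
by apply: measurableI; [exact: mf|exact: mg].
Qed.

(** The law of total probability over the fibres of [f], as an inequality. *)
Lemma pr_fibers (U : countType) (f : T -> U) (S : U -> Prop) (E : set T)
    (K : R) :
  discrete f -> measurable E -> 0 <= K ->
  (forall u, S u ->
     pr ([set w | f w = u] `&` E) <= K * pr [set w | f w = u]) ->
  pr ([set w | S (f w)] `&` E) <= K * pr [set w | S (f w)].
Proof.
move=> mf mE K0 le_fiber.
pose F n := [set w | pickle (f w) = n /\ S (f w)].
have mF n : measurable (F n).
  exact: (@discrete_event _ f (fun u => pickle u = n /\ S u)).
have mS : measurable [set w | S (f w)] by exact: discrete_event.
have SF : [set w | S (f w)] = \bigcup_n F n.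
  apply/seteqP; split=> w /=; first by move=> Sfw; exists (pickle (f w)).
  by case=> n _ [].
have tF : trivIset setT F by move=> i j _ _ [w [[<- _] [<- _]]].
have tFE : trivIset setT (fun n => F n `&` E).
  by move=> i j _ _ [w [[[<- _] _] [[<- _] _]]].
rewrite -lee_fin EFinM -!prE//; last exact: measurableI.
rewrite SF setI_bigcupl measure_bigcup//; last first.
  by move=> n _; exact: measurableI.
rewrite measure_bigcup// -nneseriesZl//.
apply: lee_nneseries => // n _.
suff : pr (F n `&` E) <= K * pr (F n).
  by rewrite -lee_fin EFinM -!prE//; exact: measurableI.
have [[u [Su eq_u]]|nu] := pselect (exists u, S u /\ pickle u = n).
  have -> : F n = [set w | f w = u].
    apply/seteqP; rewrite /F; split=> w /=; last by move=> ->.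
    by rewrite -eq_u => -[/(pcan_inj pickleK)].
  exact: le_fiber.
have -> : F n = set0.
  by apply/seteqP; rewrite /F; split=> w //= [pn Sfw]; apply: nu; exists (f w).
by rewrite set0I pr0 mulr0.
Qed.

End Discrete.

(** * Degrees along the growth of the multigraph *)

Section Degrees.
Local Open Scope nat_scope.

Definition hits (m : nat) (c : nat -> nat) (v : nat) : nat :=
  #|[pred l : 'I_m | c l == v]|.

Lemma big_ord_lift_max n (F : 'I_n.+1 -> nat) :
  \sum_i F i = \sum_(i < n) F (lift ord_max i) + F ord_max.
Proof.
rewrite big_ord_recr/=; congr (_ + _); apply: eq_bigr => i _; congr F.
by apply: val_inj; rewrite /= /bump leqNgt ltn_ord.
Qed.

Lemma degree_attach_old n (A : 'M[nat]_n) m c (i : 'I_n) :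
  degree (attach A m c) (lift ord_max i) = degree A i + hits m c i.
Proof.
rewrite /degree big_ord_lift_max mxE liftK unlift_none; congr (_ + _).
by apply: eq_bigr => j _; rewrite mxE !liftK.
Qed.

Lemma hits_sum m c v : hits m c v = \sum_(l < m) (c l == v).
Proof.
rewrite /hits -sum1_card big_mkcond.
by apply: eq_bigr => l _; rewrite inE; case: eqP.
Qed.

Lemma sum_hits n m c : (forall l, l < m -> c l < n) ->
  \sum_(v < n) hits m c v = m.
Proof.
move=> cn.
under eq_bigr do rewrite hits_sum.
rewrite exchange_big/= -[RHS]card_ord -sum1_card.
apply: eq_bigr => l _; rewrite (bigD1 (Ordinal (cn l (ltn_ord l))))//= eqxx.
rewrite big1// => v; rewrite -val_eqE /= eq_sym.
by case: eqP.
Qed.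

Lemma degree_attach_new n (A : 'M[nat]_n) m c : (forall l, l < m -> c l < n) ->
  degree (attach A m c) ord_max = m.
Proof.
move=> cn; rewrite /degree big_ord_lift_max mxE unlift_none addn0.
rewrite -[RHS](sum_hits cn).
by apply: eq_bigr => j _; rewrite mxE unlift_none liftK.
Qed.

(** The degree of [v_i] after step [t], with a plain natural number as vertex
    index so that it can be followed through the steps. *)
Definition deg x c (t i : nat) : nat := degree (graph x c t) (inord i).

(** Indexed by the preceding step [t], as in the recursion of [graph], so that
    step 1 needs no separate treatment afterwards. *)
Definition choice (c : nat -> nat -> nat) (t : nat) : nat -> nat :=
  if t is 0 then fun=> 0 else c t.+1.

Lemma choiceE c t : 0 < t -> choice c t = c t.+1.
Proof. by case: t. Qed.

Lemma inord_lift_max t i : i <= t ->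
  inord i = lift ord_max (inord i : 'I_t.+1) :> 'I_t.+2.
Proof.
move=> it; apply: val_inj; rewrite /= /bump !inordK//; last exact: leqW.
by rewrite leqNgt ltnS it.
Qed.

Lemma degS x c t i : i <= t ->
  deg x c t.+1 i = deg x c t i + hits (x t.+1) (choice c t) i.
Proof.
by move=> it; rewrite /deg inord_lift_max// [graph _ _ _]/= degree_attach_old
  inordK.
Qed.

Lemma deg_mono x c t t' i : i <= t -> t <= t' -> deg x c t i <= deg x c t' i.
Proof.
move=> it; elim: t' => [|t' IH]; first by rewrite leqn0 => /eqP ->.
rewrite leq_eqVlt ltnS => /predU1P[->//|tt'].
by rewrite degS; [exact: leq_trans (IH tt') (leq_addr _ _)|exact: leq_trans tt'].
Qed.

(** The degrees behave as in the informal model only along such histories;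
    [pr_proper] shows that almost all histories are of this kind. *)
Definition proper x c t : Prop := forall s, s < t ->
  0 < x s.+1 /\ forall l, l < x s.+1 -> choice c s l < s.+1.

Lemma proper_le x c t s : s <= t -> proper x c t -> proper x c s.
Proof. by move=> st pt u us; apply: pt; exact: leq_trans st. Qed.

Lemma deg_new x c t : 0 < t -> proper x c t -> deg x c t t = x t.
Proof.
case: t => // t _ pt; rewrite /deg.
have -> : inord t.+1 = ord_max :> 'I_t.+2 by apply: val_inj; rewrite /= inordK.
by rewrite [graph _ _ _]/= degree_attach_new//; case: (pt t).
Qed.

Lemma LambdaS x t : Lambda x t.+1 = Lambda x t + x t.+1.
Proof. by rewrite /Lambda big_nat_recr. Qed.

Lemma Lambda_gt0 x c t : 0 < t -> proper x c t -> 0 < Lambda x t.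
Proof. by case: t => // t _ pt; rewrite LambdaS ltn_addl//; case: (pt t). Qed.

Lemma sum_degree x c t : proper x c t ->
  \sum_i degree (graph x c t) i = (Lambda x t).*2.
Proof.
elim: t => [|t IH] pt.
  rewrite /Lambda big_geq// big1// => i _; rewrite /degree big1// => j _.
  by rewrite mxE.
have [_ ct] := pt t (ltnSn t).
rewrite LambdaS [graph _ _ _]/= big_ord_lift_max degree_attach_new//.
under eq_bigr do rewrite degree_attach_old.
rewrite big_split/= sum_hits// IH; last exact: proper_le pt.
by rewrite doubleD -(addnn (x _)) addnA.
Qed.

Lemma deg_gt0 x c t i : 0 < t -> i <= t -> proper x c t -> 0 < deg x c t i.
Proof.
elim: t i => // -[|t] IH i _ it pt.
  case: i it => [_|i]; last first.
    by rewrite ltnS leqn0 => /eqP ->; rewrite deg_new//; case: (pt 0).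
  rewrite degS// ltn_addl// /hits /=; case: (pt 0) => // x1 _.
  by apply/card_gt0P; exists (Ordinal x1); rewrite inE.
move: it; rewrite leq_eqVlt ltnS => /predU1P[->|it].
  by rewrite deg_new//; case: (pt t.+1).
by rewrite degS// ltn_addr// IH//; exact: proper_le pt.
Qed.

Lemma deg_inord x c t (i : 'I_t.+1) :
  degree (graph x c t) i = deg x c t i.
Proof. by rewrite /deg inord_val. Qed.

Lemma num_degree_sum n (A : 'M[nat]_n) k :
  num_degree A k = \sum_(i < n) (degree A i == k).
Proof.
rewrite /num_degree -sum1_card big_mkcond.
by apply: eq_bigr => i _; rewrite inE; case: eqP.
Qed.

(** The last step before the first change of the degree [k] of [v_s] hits [v_s]
    while its degree still is [k]; this localizes the loss of such a vertex at
    one step. *)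
Lemma degree_change x c s t k : s <= t -> deg x c s s = k ->
  deg x c t s != k ->
  exists v, [/\ s <= v, v < t, deg x c v s = k &
    0 < hits (x v.+1) (choice c v) s].
Proof.
move=> + dk; elim: t => [|t IH]; first by rewrite leqn0 => /eqP e; rewrite -e dk eqxx.
rewrite leq_eqVlt => /predU1P[<-|]; first by rewrite dk eqxx.
rewrite ltnS => st; have [dt|dt] := eqVneq (deg x c t s) k.
  rewrite degS// dt -[X in _ != X]addn0 eqn_add2l -lt0n => h.
  by exists t; rewrite ltnSn.
by move=> _; have [v [? vt ? ?]] := IH st dt; exists v; split=> //; exact: ltnW.
Qed.

End Degrees.

(** * The law of the choices of one step *)

Section Choices.
Context (R : realType) (I : finType) (m : nat) (w : I -> R).
Hypothesis w0 : forall v, 0 <= w v.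

Lemma sum_prod_weights (f : I -> R) :
  \sum_(c : {ffun 'I_m -> I}) \prod_l f (c l) = (\sum_v f v) ^+ m.
Proof.
by rewrite -(bigA_distr_bigA (fun _ : 'I_m => f)) prodr_const card_ord.
Qed.

Hypothesis w1 : \sum_v w v = 1.

Lemma weight_le1 i : w i <= 1.
Proof. by rewrite -w1 (bigD1 i)//= lerDl sumr_ge0. Qed.

(** Chernoff's bound: the number of hits of [i] is binomial and its moment
    generating function is evaluated at 1/2. *)
Lemma prob_few_hits i k :
  \sum_(c : {ffun 'I_m -> I} | (#|[pred l | c l == i]| <= k)%N) \prod_l w (c l) <=
  2 ^+ k * (1 - w i / 2) ^+ m.
Proof.
pose f v := w v * (if v == i then 2^-1 else 1).
have <- : \sum_v f v = 1 - w i / 2.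
  rewrite -[X in _ = X - _]w1 (bigD1 i)//= [in RHS](bigD1 i)//= /f eqxx.
  rewrite (eq_bigr w) /=; first by lra.
  by move=> v /negbTE ->; rewrite mulr1.
rewrite -sum_prod_weights mulr_sumr big_mkcond; apply: ler_sum => c _.
have -> : \prod_l f (c l) =
    \prod_l w (c l) * 2^-1 ^+ #|[pred l | c l == i]|.
  rewrite big_split/=; congr (_ * _).
  rewrite -prodr_const [RHS]big_mkcond/=; apply: eq_bigr => l _.
  by rewrite inE.
have pw0 : 0 <= \prod_l w (c l) by exact: prodr_ge0.
have h0 j : 0 <= (2^-1 : R) ^+ j by rewrite exprn_ge0// invr_ge0.
case: ifP => [hk|_]; last by rewrite !mulr_ge0// exprn_ge0.
rewrite mulrCA ler_peMr// exprVn -ler_pdivrMr ?invr_gt0 ?exprn_gt0//.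
by rewrite invrK mul1r ler_weXn2l// ler1n.
Qed.

Lemma bernoulli_ge (x : R) n : 0 <= x <= 1 -> 1 - n%:R * x <= (1 - x) ^+ n.
Proof.
move=> /andP[x0 x1]; elim: n => [|n IH]; first by rewrite mul0r subr0 expr0.
rewrite exprS -natr1.
apply: (@le_trans _ _ ((1 - x) * (1 - n%:R * x))); last first.
  by rewrite ler_wpM2l// subr_ge0.
have : 0 <= n%:R * x * x by rewrite !mulr_ge0.
by nra.
Qed.

(** Complement of missing [i] in all [m] independent trials. *)
Lemma prob_hit i :
  \sum_(c : {ffun 'I_m -> I} | [exists l, c l == i]) \prod_l w (c l) <= m%:R * w i.
Proof.
pose f v := w v * (v != i)%:R.
have fE : \sum_v f v = 1 - w i.
  rewrite -[X in _ = X - _]w1 (bigD1 i)//= [in RHS](bigD1 i)//= /f eqxx.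
  rewrite (eq_bigr w) /=; first by lra.
  by move=> v ->; rewrite mulr1.
have : \sum_(c : {ffun 'I_m -> I} | ~~ [exists l, c l == i])
    \prod_l w (c l) = (1 - w i) ^+ m.
  rewrite -fE -sum_prod_weights big_mkcond; apply: eq_bigr => c _.
  rewrite big_split/=; case: ifPn => [nh|/negPn/existsP[l cl]].
    rewrite [X in _ * X]big1 ?mulr1// => l _.
    by move: nh; rewrite negb_exists => /forallP/(_ l) ->.
  by rewrite [X in _ * X](bigD1 l)//= cl mul0r mulr0.
have := sum_prod_weights w; rewrite w1 expr1n.
rewrite (bigID (fun c : {ffun 'I_m -> I} => [exists l, c l == i]))/= => + eqn.
rewrite eqn.
have := @bernoulli_ge (w i) m; rewrite w0 weight_le1 => /(_ isT).
by lra.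
Qed.

End Choices.

(** * Tail and truncated mean of a power law *)

(** Young's inequality with the second factor 1; the graph of the concave
    function lies below its tangent at 1. *)
Lemma powR_le_affine (R : realType) (y s : R) : 0 <= y -> 0 < s < 1 ->
  y `^ s <= s * y + (1 - s).
Proof.
move=> y0 /andP[s0 s1].
have c0 : 0 < 1 - s by rewrite subr_gt0.
have := @conjugate_powR R (y `^ s) 1 s^-1 (1 - s)^-1 (powR_ge0 _ _) ler01.
rewrite !invr_gt0 !invrK => /(_ s0 c0).
rewrite -powRrM mulfV ?gt_eqF// powRr1// powR1 mulr1 mul1r => h.
rewrite [s * y]mulrC.
apply: (le_trans (h _)); first by rewrite addrC subrK.
by [].
Qed.

(** Comparison of the sum with the integral of [x `^ (s - 1)]; the increment of
    [x `^ s / s] is bounded below by concavity. *)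
Lemma sum_powR_le (R : realType) (s : R) n : 0 < s < 1 ->
  s * \sum_(1 <= i < n.+1) i%:R `^ (s - 1) <= n%:R `^ s.
Proof.
move=> /[dup] s01 /andP[s0 s1]; elim: n => [|n IH].
  by rewrite big_geq// mulr0 powR_ge0.
rewrite big_nat_recr//= mulrDr (le_trans (lerD IH (lexx _)))//.
set a : R := n.+1%:R.
have a0 : 0 < a by rewrite ltr0n.
have y0 : 0 <= n%:R / a by rewrite divr_ge0// ltW.
have -> : n%:R `^ s = a `^ s * (n%:R / a) `^ s.
  by rewrite -powRM ?(ltW a0)// mulrC divfK// gt_eqF.
have -> : a `^ (s - 1) = a `^ s / a.
  rewrite powRB; first by rewrite powRr1// ltW.
  by rewrite (lt0r_neq0 a0) implybT.
have yE : n%:R / a = 1 - a^-1.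
  have aE : n%:R = a - 1 by rewrite /a -natr1 addrK.
  by rewrite aE mulrBl mul1r divff// lt0r_neq0.
have := powR_le_affine y0 s01; rewrite yE => h.
have p0 : 0 < a `^ s by exact: powR_gt0.
apply: (@le_trans _ _ (a `^ s * (s * (1 - a^-1) + (1 - s)) + s * (a `^ s / a))).
  by rewrite lerD2r ler_wpM2l// ltW.
by rewrite le_eqVlt; apply/orP; left; apply/eqP; ring.
Qed.

Section PowerLaw.
Context d (T : measurableType d) (R : realType) (P : probability T R).
Local Notation pr := (pr P).
Context (Y : T -> nat) (alpha beta : R).
Hypotheses (mY : discrete Y) (alpha12 : 1 < alpha < 2)
  (Y_neq0 : pr [set w | Y w = 0%N] = 0)
  (Y_law : forall n, (0 < n)%N ->
     pr [set w | Y w = n] = beta * n%:R `^ (- alpha)).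

Definition tail (L : nat) : R := pr [set w | (L < Y w)%N].

Definition truncated_mean (L : nat) : R :=
  \sum_(0 <= n < L.+1) n%:R * pr [set w | Y w = n].

Let mEv (S : nat -> Prop) : measurable [set w | S (Y w)].
Proof. exact: discrete_event. Qed.

Let mtail L : measurable [set w | (L < Y w)%N].
Proof. exact: (mEv (fun n => L < n)%N). Qed.

Let matom n : measurable [set w | Y w = n].
Proof. exact: (mEv (fun m => m = n)). Qed.

Lemma tail_ge0 L : 0 <= tail L. Proof. exact: pr_ge0. Qed.

Lemma tail_small (eps : R) : 0 < eps -> exists M, forall L, (M <= L)%N ->
  tail L <= eps.
Proof.
move=> eps0.
have : P [set w | (L < Y w)%N] @[L --> \oo] -->
    P (\bigcap_L [set w | (L < Y w)%N]).
  apply: nonincreasing_cvg_mu => //.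
  - by rewrite ltey_eq fin_num_measure.
  - exact: bigcapT_measurable.
  - move=> i j ij; apply/subsetPset => w /=; exact: leq_ltn_trans.
rewrite (_ : \bigcap_L _ = set0) ?measure0; last first.
  by apply/seteqP; split=> w // /(_ (Y w) I) /=; rewrite ltnn.
move/fine_cvgP => [_] /cvgrPdist_le /(_ _ eps0)[M _ h].
exists M => L ML; have := h L ML.
by rewrite /= sub0r normrN ger0_norm// fine_ge0.
Qed.

Lemma tail_cover L M : (L <= M)%N ->
  tail L <= \sum_(L.+1 <= n < M.+1) pr [set w | Y w = n] + tail M.
Proof.
move=> LM; rewrite /tail.
pose D n := if (n <= M)%N then [set w | Y w = n] else [set w | (M < Y w)%N].
have -> : [set w | (M < Y w)%N] = D M.+1 by rewrite /D ltnn.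
rewrite (eq_big_nat _ _ (F2 := fun n => pr (D n))); last first.
  by move=> n /andP[_ nM]; rewrite /D -ltnS nM.
rewrite -big_nat_recr ?ltnS//=; apply: pr_cover => //.
  by move=> n; rewrite /D; case: ifP.
move=> w /= LY; have [YM|MY] := leqP (Y w) M.
  by exists (Y w); rewrite /D ?YM// mem_index_iota LY ltnS leqW.
by exists M.+1; rewrite /D ?ltnn// mem_index_iota !ltnS LM leqnn.
Qed.

Lemma tail_ge_sum L (f : nat -> nat) a b : injective f ->
  (forall n, (a <= n)%N -> (L < f n)%N) ->
  \sum_(a <= n < b) pr [set w | Y w = f n] <= tail L.
Proof.
move=> finj Lf; apply: pr_disjoint => //; first exact: iota_uniq.
- by move=> n w; rewrite mem_index_iota => /andP[an _] /= ->; exact: Lf.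
- by move=> n m w _ _ /= -> /finj.
Qed.

(** The probabilities add up to one, so that the constant cannot vanish. *)
Lemma power_law_beta_gt0 : 0 < beta.
Proof.
have [M hM] := @tail_small 2^-1 ltac:(by rewrite invr_gt0).
have := tail_cover (leq0n M); have := hM M (leqnn M).
have -> : tail 0 = 1.
  rewrite -(prT P) (pr_setD P measurableT (matom 0)) !setTI Y_neq0 add0r.
  congr pr; apply/seteqP; split=> w /=; first by move=> + e; rewrite e.
  by move/eqP; rewrite -lt0n.
have [//|b0] := ltP 0 beta.
have : \sum_(1 <= n < M.+1) pr [set w | Y w = n] <= 0.
  rewrite big_nat; apply: sumr_le0 => n /andP[n0 _].
  by rewrite Y_law// mulr_le0_ge0// powR_ge0.
by lra.
Qed.

(** The tail beyond [m * L] is at least the mass of the multiples of [m] there,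
    and this is the tail beyond [L], scaled: hence the tail decays no faster
    than polynomially, and events of the scales [L] and [m * L] are equally
    likely up to a constant. *)
Lemma tail_scale L m : (0 < m)%N -> tail L <= m%:R `^ alpha * tail (m * L).
Proof.
move=> m0; apply/ler_addgt0Pr => eps eps0.
have [M hM] := tail_small eps0.
apply: (le_trans (tail_cover (leq_maxr M L))); apply: lerD; last first.
  by apply: hM; exact: leq_maxl.
have mr0 : 0 < m%:R `^ alpha :> R by rewrite powR_gt0// ltr0n.
rewrite -ler_pdivrMl//.
apply: le_trans (@tail_ge_sum _ (muln m) L.+1 (maxn M L).+1 _ _); last 2 first.
- by move=> a b /eqP; rewrite eqn_mul2l gtn_eqF//= => /eqP.
- by move=> n Ln; rewrite ltn_pmul2l.
rewrite mulr_sumr le_eqVlt; apply/orP; left; apply/eqP.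
apply: eq_big_nat => n /andP[Ln _].
have n0 : (0 < n)%N by exact: leq_trans Ln.
rewrite !Y_law ?muln_gt0 ?m0// natrM powRM// (powRN m%:R).
by rewrite mulrCA.
Qed.

(** Only the values in the interval from [L] to [2 * L] are kept. *)
Lemma tail_lower L : (0 < L)%N ->
  beta * L%:R `^ (2 - alpha) <= 4 * L%:R * tail L.
Proof.
move=> L0; have b0 := power_law_beta_gt0.
move: alpha12 => /andP[a1 a2].
have Lr : 0 < L%:R :> R by rewrite ltr0n.
have h2 : L%:R `^ (- alpha) <= 4 * (2 * L)%:R `^ (- alpha) :> R.
  rewrite natrM powRM// mulrA ler_peMl ?powR_ge0//.
  rewrite powRN ler_pdivlMr ?powR_gt0// mul1r.
  rewrite (_ : 4 = 2 `^ 2 :> R); last by rewrite powR_mulrn// -natrX.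
  by rewrite ler_powR ?ler1n// ltW.
have hsum : L%:R * (beta * (2 * L)%:R `^ (- alpha)) <= tail L.
  apply: le_trans (@tail_ge_sum _ id L.+1 (2 * L).+1 _ _) => //.
  rewrite mulr_natl -[X in _ *+ X](_ : ((2 * L).+1 - L.+1 = L)%N); last by lia.
  rewrite -sumr_const_nat; apply: ler_sum_nat => n /andP[Ln n2L].
  have n0 : (0 < n)%N by exact: leq_ltn_trans Ln.
  rewrite Y_law// ler_wpM2l ?(ltW b0)// !powRN.
  rewrite lef_pV2 ?posrE ?powR_gt0 ?ltr0n//; last by lia.
  by rewrite ge0_ler_powR ?nnegrE ?ler_nat//; lra.
rewrite powRB ?(lt0r_neq0 Lr) ?implybT// powR_mulrn// -powRN.
apply: (@le_trans _ _ (4 * L%:R * (L%:R * (beta * (2 * L)%:R `^ (- alpha))))); last first.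
  by rewrite ler_wpM2l// mulr_ge0// ltW.
apply: (@le_trans _ _ (beta * (L%:R ^+ 2 * (4 * (2 * L)%:R `^ (- alpha))))).
  by rewrite ler_wpM2l ?(ltW b0)// ler_wpM2l// exprn_ge0// ltW.
by rewrite le_eqVlt; apply/orP; left; apply/eqP; ring.
Qed.

(** The exponent being less than 2, the truncated mean is dominated by the
    largest values. *)
Lemma truncated_mean_le L : (0 < L)%N ->
  truncated_mean L <= 4 / (2 - alpha) * L%:R * tail L.
Proof.
move=> L0; have b0 := power_law_beta_gt0; have := tail_lower L0.
move: alpha12 => /andP[a1 a2].
have s01 : 0 < 2 - alpha < 1 by apply/andP; split; lra.
have s0 : 0 < 2 - alpha by lra.
have -> : truncated_mean L = beta * \sum_(1 <= n < L.+1) n%:R `^ (2 - alpha - 1).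
  rewrite /truncated_mean big_nat_recl// mul0r add0r big_add1/= mulr_sumr.
  apply: eq_big_nat => n _; rewrite Y_law// mulrCA; congr (_ * _).
  rewrite (_ : 2 - alpha - 1 = 1 - alpha); last by ring.
  by rewrite powRD ?powRr1// pnatr_eq0 implybT.
move=> h; have := sum_powR_le L s01.
rewrite -(ler_pM2l b0) => /le_trans/(_ h).
by rewrite mulrCA -ler_pdivlMl// !mulrA [_^-1 * 4]mulrC.
Qed.

End PowerLaw.

(** * One step of the model *)

Section Model.
Context d (T : measurableType d) (R : realType) (P : probability T R).
Context d' (T' : measurableType d') (Q : probability T' R)
  (X0 : {RV Q >-> nat}).
Context (X : nat -> {RV P >-> nat}) (C : nat -> nat -> {RV P >-> nat}).
Hypothesis model : PARID X C X0.
Hypothesis X0_pos : forall w, (1 <= X0 w)%N.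
Local Notation pr := (pr P).
Local Notation xs w := (X ^~ w).
Local Notation cs w := (fun s l => C s l w).
Local Notation rgraph := (Defs.rgraph X C).
Local Notation rLambda := (rLambda X).
Local Notation rdeg t w i := (deg (xs w) (cs w) t i).
Local Notation rproper t w := (proper (xs w) (cs w) t).

Lemma discrete_RV (Y : {RV P >-> nat}) : discrete Y.
Proof.
by move=> n; rewrite -[X in measurable X]setTI; apply: measurable_funP.
Qed.

Lemma measurable_RV (Y : {RV P >-> nat}) (S : nat -> Prop) :
  measurable [set w | S (Y w)].
Proof. exact: discrete_event (discrete_RV Y). Qed.

(** The sequence of choices has random length; as a finite sequence of natural
    numbers it still is a discrete variable, and the next multigraph is a
    function of it. *)
Lemma discrete_rchoices s :
  discrete (fun w => mkseq (fun l => C s l w) (X s w)).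
Proof.
move=> v.
have -> : (fun w => mkseq (fun l => C s l w) (X s w)) @^-1` [set v] =
    [set w | X s w = size v] `&`
    \bigcap_l [set w | (l < size v)%N -> C s l w = nth 0%N v l].
  apply/seteqP; split=> w /=.
    move=> <-; rewrite size_mkseq; split=> // l _ /= lX.
    by rewrite nth_mkseq.
  case=> eX eC; apply: (@eq_from_nth _ 0%N); rewrite size_mkseq// => l lX.
  by rewrite nth_mkseq// eC// -eX.
apply: measurableI; first exact: (measurable_RV (X s) (fun n => n = size v)).
apply: bigcapT_measurable => l.
exact: (measurable_RV (C s l) (fun n => (l < size v)%N -> n = nth 0%N v l)).
Qed.

Lemma attach_mkseq n (A : 'M[nat]_n) m c :
  attach A m (nth 0%N (mkseq c m)) = attach A m c.
Proof.
apply/matrixP => i j; rewrite !mxE.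
have E v : #|[pred l : 'I_m | nth 0%N (mkseq c m) l == v]| =
           #|[pred l : 'I_m | c l == v]|.
  by apply: eq_card => l; rewrite !inE nth_mkseq.
by case: unlift => [?|]; case: unlift => [?|].
Qed.

Lemma discrete_rgraph t : discrete (rgraph t).
Proof.
elim: t => [|t IH].
  have -> : rgraph 0 = (fun=> const_mx 0%N) by [].
  move=> u; have [->|nu] := eqVneq u (const_mx 0%N).
    by rewrite (_ : _ @^-1` _ = setT)//; apply/seteqP; split.
  rewrite (_ : _ @^-1` _ = set0)//; apply/seteqP; split=> w //= e.
  by rewrite e eqxx in nu.
pose step (p : 'M[nat]_t.+1 * seq nat) : 'M[nat]_t.+2 :=
  attach p.1 (size p.2) (if t is 0 then fun=> 0%N else nth 0%N p.2).
have -> : rgraph t.+1 =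
    fun w => step (rgraph t w, mkseq (fun l => C t.+1 l w) (X t.+1 w)).
  apply/funext => w; rewrite /step /Defs.rgraph/= size_mkseq.
  by case: t {IH step} => // t; rewrite attach_mkseq.
exact: discrete_comp (discrete_pair IH (discrete_rchoices _)).
Qed.

Lemma discrete_rLambda t : discrete (rLambda t).
Proof.
elim: t => [|t IH].
  move=> n; rewrite (_ : _ @^-1` _ = [set w : T | 0%N = n])//; last first.
    by apply/seteqP; split=> w; rewrite /= /Defs.rLambda /Lambda big_geq.
  exact: (measurable_RV (X 0) (fun=> 0%N = n)).
have -> : rLambda t.+1 = fun w => addn (rLambda t w) (X t.+1 w).
  by apply/funext => w; rewrite /Defs.rLambda LambdaS.
exact: (discrete_comp (fun p : nat * nat => (p.1 + p.2)%N)
  (discrete_pair IH (discrete_RV (X t.+1)))).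
Qed.

(** The conditioning variables of the law of the choices of step [t.+1]. *)
Definition state t (w : T) : 'M[nat]_t.+1 * nat * nat :=
  (rgraph t w, rLambda t w, X t.+1 w).

Lemma discrete_state t : discrete (state t).
Proof.
exact: (discrete_pair (discrete_pair (@discrete_rgraph t) (discrete_rLambda t))
  (discrete_RV (X t.+1))).
Qed.

Lemma measurable_rgraph t (S : 'M[nat]_t.+1 -> Prop) :
  measurable [set w | S (rgraph t w)].
Proof. exact: discrete_event (@discrete_rgraph t). Qed.

Lemma measurable_rdeg t i (S : nat -> Prop) :
  measurable [set w | S (rdeg t w i)].
Proof. exact: (measurable_rgraph (fun g => S (degree g (inord i)))). Qed.

Lemma measurable_proper t : measurable [set w | rproper t w].
Proof.
pose ok s l w := (0 < X s.+1 w)%N /\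
  ((l < X s.+1 w)%N -> (choice (cs w) s l < s.+1)%N).
have -> : [set w | rproper t w] =
    \bigcap_s \bigcap_l [set w | (s < t)%N -> ok s l w].
  apply/seteqP; split=> w /=.
    by move=> pt s _ l _ /= st; have [x0 cl] := pt s st; split=> // /cl.
  move=> ok_w s st; split; first by have [] := ok_w s I 0%N I st.
  by move=> l; have [_] := ok_w s I l I st.
apply: bigcapT_measurable => s; apply: bigcapT_measurable => l.
have := discrete_pair (discrete_RV (X s.+1)) (discrete_RV (C s.+1 l)).
move/(discrete_event (fun p : nat * nat => (s < t)%N -> (0 < p.1)%N /\
  ((l < p.1)%N -> ((if s is 0 then 0 else p.2) < s.+1)%N))).
congr (measurable _); apply/seteqP; split=> w /=; rewrite /ok;
  by case: s.
Qed.

Section Step.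
Variables (t : nat) (t1 : (1 <= t)%N) (g : 'M[nat]_t.+1) (L m : nat).

Let past := [set w | [/\ rgraph t w = g, rLambda t w = L & X t.+1 w = m]].
Let chosen (c : {ffun 'I_m -> 'I_t.+1}) :=
  [set w | forall l : 'I_m, C t.+1 l w = c l].
Let weight (v : 'I_t.+1) : R := (degree g v)%:R / (2 * L)%:R.

Let pastE : past = [set w | state t w = (g, L, m)].
Proof.
by apply/seteqP; split=> w; rewrite /past /state /=; [case=> -> -> ->|case=> -> -> ->].
Qed.

Let measurable_past : measurable past.
Proof. by rewrite pastE; exact: discrete_state. Qed.

Let measurable_chosen c : measurable (chosen c).
Proof.
have -> : chosen c = \bigcap_l
    [set w | forall h : (l < m)%N, C t.+1 l w = c (Ordinal h)].
  apply/seteqP; split=> w /=.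
    by move=> cw l _ /= h; rewrite -cw.
  by move=> cw [l h]; rewrite (cw l I h).
apply: bigcapT_measurable => l.
exact: (measurable_RV (C t.+1 l) (fun n => forall h : (l < m)%N, n = c (Ordinal h))).
Qed.

Let chosen_inj c c' w : chosen c w -> chosen c' w -> c = c'.
Proof.
by move=> cw c'w; apply/ffunP => l; apply: val_inj; rewrite /= -cw -c'w.
Qed.

Lemma pr_chosen (c : {ffun 'I_m -> 'I_t.+1}) :
  pr (past `&` chosen c) = pr past * \prod_l weight (c l).
Proof.
have := PARID_choice model g L c t1; rewrite -/past -/(chosen c) => h.
apply: EFin_inj; rewrite EFinM -!prE//; exact: measurableI.
Qed.

Hypotheses (sum_g : (\sum_i degree g i)%N = L.*2) (L0 : (0 < L)%N).

Let weight1 : \sum_v weight v = 1.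
Proof.
rewrite -mulr_suml -natr_sum sum_g mul2n divff//.
by rewrite pnatr_eq0 double_eq0 -lt0n.
Qed.

(** The product weights of all choice vectors add up to one, so that, given the
    past, no event outside of them has positive probability; on the choice
    vectors the event [E] is bounded by its combinatorial description [B]. *)
Lemma pr_step_le (E : set T) (B : pred {ffun 'I_m -> 'I_t.+1}) (K : R) :
  measurable E ->
  (forall c w, past w -> chosen c w -> E w -> B c) ->
  \sum_(c | B c) \prod_l weight (c l) <= K ->
  pr (past `&` E) <= K * pr past.
Proof.
move=> mE EB BK.
have fin_index D : \sum_(c | D c) pr (past `&` chosen c) =
    pr past * \sum_(c | D c) \prod_l weight (c l).
  by rewrite mulr_sumr; apply: eq_bigr => c _; rewrite pr_chosen.
have mPC c : measurable (past `&` chosen c) by exact: measurableI.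
pose A := \big[setU/set0]_(c : {ffun 'I_m -> 'I_t.+1}) (past `&` chosen c).
have mA : measurable A by exact: bigsetU_measurable.
have AE w : A w <-> exists c, past w /\ chosen c w.
  rewrite /A -bigcup_seq; split=> [[c _ []]|[c ?]]; first by exists c.
  by exists c => //; exact: mem_index_enum.
have pA : pr A = pr past.
  rewrite (@pr_partition _ _ _ P _ (index_enum {ffun 'I_m -> 'I_t.+1})
    (fun c => past `&` chosen c))//.
  - by rewrite fin_index sum_prod_weights weight1 expr1n mulr1.
  - exact: index_enum_uniq.
  - move=> w; rewrite AE; split=> [[c cw]|[c _ cw]]; last by exists c.
    by exists c; first exact: mem_index_enum.
  - by move=> c c' w _ _ [_ cw] [_ /(chosen_inj cw)].
have nA : pr (past `&` ~` A) = 0.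
  have := pr_setD P measurable_past mA; rewrite (setIidr (B := A)).
    by rewrite pA; lra.
  by move=> w /AE[c []].
have mAE : measurable (past `&` E) by exact: measurableI.
have mBE : measurable (\big[setU/set0]_(c | B c) (past `&` chosen c)).
  exact: bigsetU_measurable.
apply: (@le_trans _ _ (pr (past `&` ~` A) +
    pr (\big[setU/set0]_(c | B c) (past `&` chosen c)))).
  apply: pr_le2 => //; first by apply: measurableI => //; exact: measurableC.
  move=> w [pw Ew]; have [/AE[c [_ cw]]|nAw] := pselect (A w); last by left.
  right; rewrite -bigcup_seq_cond; exists c => //.
  by apply/andP; split; [exact: mem_index_enum|exact: EB cw Ew].
rewrite nA add0r mulrC (le_trans _ (ler_wpM2l (pr_ge0 _ _) BK))//.
rewrite -fin_index -[leRHS]big_filter; apply: pr_cover => // w.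
rewrite -bigcup_seq_cond => -[c /andP[_ Bc] ?].
by exists c => //; rewrite mem_filter Bc mem_index_enum.
Qed.

End Step.

Lemma pr_X t (S : nat -> Prop) : (1 <= t)%N ->
  pr [set w | S (X t w)] = fine (Q (X0 @^-1` S)).
Proof.
by move=> t1; have := PARID_copies model S t1; rewrite /distribution /pushforward => <-.
Qed.

Lemma pr_X_eq0 t : (1 <= t)%N -> pr [set w | X t w = 0%N] = 0.
Proof.
move=> t1; rewrite (pr_X (fun n => n = 0%N))//.
rewrite (_ : _ @^-1` _ = set0) ?measure0//.
by apply/seteqP; split=> w //= e; have := X0_pos w; rewrite e.
Qed.

Section OneStep.

Let consistent t (u : 'M[nat]_t.+1 * nat * nat) : Prop :=
  (\sum_i degree u.1.1 i)%N = u.1.2.*2 /\ (0 < u.1.2)%N.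

Let proper_consistent t w : (1 <= t)%N -> rproper t w ->
  consistent (state t w).
Proof.
move=> t1 pt; split; first exact: sum_degree pt.
exact: Lambda_gt0 pt.
Qed.

Let pr_state_le t (S : 'M[nat]_t.+1 * nat * nat -> Prop) (E : set T)
    (B : forall g L m, pred {ffun 'I_m -> 'I_t.+1}) (K : R) :
  (1 <= t)%N -> measurable E -> 0 <= K ->
  (forall u, S u -> consistent u) ->
  (forall g L m w (c : {ffun 'I_m -> 'I_t.+1}), S (g, L, m) ->
     rgraph t w = g -> X t.+1 w = m ->
     (forall l : 'I_m, C t.+1 l w = c l) -> E w -> B g L m c) ->
  (forall g L m, S (g, L, m) ->
     \sum_(c | B g L m c) \prod_l ((degree g (c l))%:R / (2 * L)%:R) <= K) ->
  pr ([set w | S (state t w)] `&` E) <= K * pr [set w | S (state t w)].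
Proof.
move=> t1 mE K0 Sc EB BK; apply: (pr_fibers (@discrete_state t)) => //.
move=> [[g L] m] Su; have [/= sg L0] := Sc _ Su.
have -> : [set w | state t w = (g, L, m)] =
    [set w | [/\ rgraph t w = g, rLambda t w = L & X t.+1 w = m]].
  by apply/seteqP; split=> w /=; rewrite /state; [case=> -> -> ->|case=> -> -> ->].
apply: (@pr_step_le t t1 g L m sg L0 E (B g L m)) => //; last exact: BK.
by move=> c w [gw _ mw] cw Ew; exact: EB Ew.
Qed.

(** Almost surely the model never makes a meaningless choice. Hence the total
    degree of the multigraph is twice the separate variable [Lambda]. *)
Lemma pr_proper t : pr (~` [set w | rproper t w]) = 0.
Proof.
elim: t => [|t IH].
  by rewrite (_ : ~` _ = set0) ?pr0//; apply/seteqP; split=> w //=; apply.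
pose E := [set w | ~ forall l, (l < X t.+1 w)%N -> (choice (cs w) t l < t.+1)%N].
pose F := [set w | consistent (state t w)] `&` E.
have mE : measurable E.
  pose ok (s : seq nat) := all (fun v => v < t.+1)%N s.
  case: t @E {F IH} => [|t] E in ok *.
    by rewrite (_ : E = set0)//; apply/seteqP; split=> w //=; apply.
  rewrite (_ : E = [set w | ~ ok (mkseq (fun l => C t.+2 l w) (X t.+2 w))]).
    exact: (discrete_event (fun s => ~ ok s) (discrete_rchoices _)).
  apply/seteqP; split=> w /= nE H; apply: nE.
    move=> l lX; move/(all_nthP 0%N): H => /(_ l).
    by rewrite size_mkseq nth_mkseq// => ->.
  by apply/(all_nthP 0%N) => l; rewrite size_mkseq => lX; rewrite nth_mkseq// H.
have mF : measurable F.
  by apply: measurableI => //; exact: discrete_event (@discrete_state t).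
have pF : pr F = 0.
  have [t0|t0] := posnP t.
    rewrite (_ : F = set0) ?pr0//; apply/seteqP; split=> w //= -[_].
    by apply; rewrite t0.
  apply/eqP; rewrite eq_le pr_ge0 andbT.
  rewrite -[leRHS](mul0r (pr [set w | consistent (state t w)])).
  apply: (@pr_state_le t _ _ (fun _ _ _ => xpred0)) => //.
    move=> g L m w c _ _ mw cw; case=> l; rewrite mw => lm.
    by rewrite choiceE// (cw (Ordinal lm)).
  by move=> g L m _; rewrite big_pred0.
have mP s : measurable (~` [set w | rproper s w]).
  exact: measurableC (measurable_proper _).
have mX0 : measurable [set w | X t.+1 w = 0%N].
  exact: (measurable_RV (X t.+1) (fun n => n = 0%N)).
apply/eqP; rewrite eq_le pr_ge0 andbT.
apply: (le_trans (@pr_le2 _ _ _ P _ (~` [set w | rproper t w])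
   ([set w | X t.+1 w = 0%N] `|` F) _ _ _ _)) => //.
- exact: measurableU.
- move=> w /= npt; have [pt|] := pselect (rproper t w); last by left.
  right; have [x0|x0] := posnP (X t.+1 w); [by left|right].
  have [ct|ct] := pselect (forall l, (l < X t.+1 w)%N -> (choice (cs w) t l < t.+1)%N).
    exfalso; apply: npt => s; rewrite ltnS leq_eqVlt => /predU1P[->//|].
    exact: pt.
  split=> //; have [t0|t0] := posnP t; last exact: proper_consistent.
  by exfalso; apply: ct; rewrite t0.
rewrite IH add0r (le_trans (@pr_le2 _ _ _ P _ _ F _ mX0 mF _))//.
- exact: measurableU.
- by rewrite pF addr0 pr_X_eq0.
Qed.

Let pr_state_proper_le t (S : 'M[nat]_t.+1 * nat * nat -> Prop) (A E : set T) :
  measurable A -> measurable E ->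
  (forall w, rproper t w -> A w -> S (state t w)) ->
  pr (A `&` E) <= pr ([set w | S (state t w)] `&` E).
Proof.
move=> mA mE AS; rewrite -[leRHS]add0r -(pr_proper t).
apply: pr_le2; [exact: measurableI| |apply: measurableI|] => //.
- exact: measurableC (measurable_proper _).
- exact: discrete_event (@discrete_state t).
- move=> w [Aw Ew]; have [pt|npt] := pselect (rproper t w); last by left.
  by right; split=> //; exact: AS.
Qed.

Lemma hits_chosen t m w (c : {ffun 'I_m -> 'I_t.+1}) i : (1 <= t)%N ->
  (i <= t)%N -> X t.+1 w = m -> (forall l : 'I_m, C t.+1 l w = c l) ->
  hits (X t.+1 w) (choice (cs w) t) i = #|[pred l | c l == inord i]|.
Proof.
move=> t1 it -> cw; apply: eq_card => l.
by rewrite !inE choiceE// cw -val_eqE /= inordK.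
Qed.

(** Every old vertex has degree at least 1, hence is chosen by each of the many
    new edges with probability at least [1 / (2 * L)]. *)
Lemma pr_small_degree t i k L M : (1 <= t)%N -> (i <= t)%N -> (1 <= L)%N ->
  pr ([set w | (rLambda t w <= L)%N /\ (M < X t.+1 w)%N] `&`
      [set w | (rdeg t.+1 w i <= k)%N]) <=
  2 ^+ k * (1 - (4 * L%:R)^-1) ^+ M * pr [set w | (M < X t.+1 w)%N].
Proof.
move=> t1 it L1.
set K := 2 ^+ k * _ ^+ M.
have L0 : 0 < L%:R :> R by rewrite ltr0n.
have y0 : 0 <= 1 - (4 * L%:R)^-1 :> R.
  by rewrite subr_ge0 invf_le1 ?mulr_gt0//; have : 1 <= L%:R :> R; [rewrite ler1n|lra].
have K0 : 0 <= K by rewrite mulr_ge0// exprn_ge0.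
pose S (u : 'M[nat]_t.+1 * nat * nat) := [/\ consistent u,
  (0 < degree u.1.1 (inord i))%N, (u.1.2 <= L)%N & (M < u.2)%N].
have mA : measurable [set w | (rLambda t w <= L)%N /\ (M < X t.+1 w)%N].
  exact: (discrete_event (fun u => (u.1.2 <= L)%N /\ (M < u.2)%N) (@discrete_state t)).
have mE : measurable [set w | (rdeg t.+1 w i <= k)%N].
  exact: (measurable_rdeg _ _ (fun n => n <= k)%N).
apply: (le_trans (@pr_state_proper_le t S _ _ mA mE _)).
  move=> w pt [/= ? ?]; split=> //; first exact: proper_consistent.
  exact: deg_gt0 pt.
apply: (le_trans (@pr_state_le t S _
  (fun _ _ _ c => #|[pred l | c l == inord i]| <= k)%N K t1 mE K0 _ _ _)).
- by move=> u [].
- move=> g L' m w c _ _ mw cw /=; apply: leq_trans.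
  by rewrite degS// (hits_chosen t1 it mw cw) leq_addl.
- move=> g L' m [/= [/= sg L'0] g0 L'L mM].
  have L'0r : 0 < L'%:R :> R by rewrite ltr0n.
  have w1 : \sum_v (degree g v)%:R / (2 * L')%:R = 1 :> R.
    by rewrite -mulr_suml -natr_sum sg mul2n divff// pnatr_eq0 double_eq0 -lt0n.
  have w0 v : 0 <= (degree g v)%:R / (2 * L')%:R :> R by rewrite divr_ge0.
  have := prob_few_hits m w0 w1 (inord i) k.
  move/le_trans; apply.
  rewrite ler_wpM2l ?exprn_ge0//.
  have wi : (4 * L%:R)^-1 <= (degree g (inord i))%:R / (2 * L')%:R / 2 :> R.
    rewrite -mulrA -invfM -!natrM.
    apply: (@le_trans _ _ (2 * L' * 2)%:R^-1); last first.
      by rewrite ler_peMl ?invr_ge0// ler1n.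
    rewrite lef_pV2 ?posrE ?ltr0n ?muln_gt0 ?L'0//.
    by rewrite ler_nat; lia.
  have wle : (degree g (inord i))%:R / (2 * L')%:R <= 1 :> R.
    by apply: (weight_le1 _ w1) => v; rewrite divr_ge0.
  apply: (@le_trans _ _ ((1 - (4 * L%:R)^-1) ^+ m)).
    by rewrite lerXn2r ?nnegrE//; lra.
  by apply: ler_wiXn2l => //; exact: ltnW.
rewrite ler_wpM2l// pr_mono//.
- exact: discrete_event (@discrete_state t).
- exact: (measurable_RV (X t.+1) (fun n => M < n)%N).
- by move=> w [].
Qed.

Definition touched (t i k : nat) : set T :=
  [set w | rdeg t w i = k /\ (0 < hits (X t.+1 w) (choice (cs w) t) i)%N].

Lemma measurable_touched t i k : (i <= t)%N -> measurable (touched t i k).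
Proof.
move=> it; have -> : touched t i k =
    [set w | rdeg t w i = k] `&` [set w | (rdeg t w i < rdeg t.+1 w i)%N].
  by apply/seteqP; split=> w /=; rewrite degS// -[X in (X < _)%N]addn0 ltn_add2l.
apply: measurableI; first exact: (measurable_rdeg _ _ (fun n => n = k)).
exact: (discrete_event (fun u : 'M[nat]_t.+1 * 'M[nat]_t.+2 =>
  degree u.1 (inord i) < degree u.2 (inord i))%N
  (discrete_pair (@discrete_rgraph t) (@discrete_rgraph t.+1))).
Qed.

(** Each of the [x] edges chooses the vertex with probability
    [k / (2 * Lambda)]. The degree is part of the bounded event only, not of the
    event on the right, whose probability is thus a matter of the independent
    variables [X] alone. *)
Lemma pr_hit t i k M x : (1 <= t)%N -> (i <= t)%N -> (1 <= M)%N ->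
  pr ([set w | (M < rLambda t w)%N /\ X t.+1 w = x] `&`
      touched t i k) <=
  x%:R * k%:R / (2 * M%:R) * pr [set w | (M < rLambda t w)%N /\ X t.+1 w = x].
Proof.
move=> t1 it M1.
have M0 : 0 < M%:R :> R by rewrite ltr0n.
pose S (u : 'M[nat]_t.+1 * nat * nat) :=
  [/\ consistent u, (M < u.1.2)%N & u.2 = x].
have mA : measurable [set w | (M < rLambda t w)%N /\ X t.+1 w = x].
  exact: (discrete_event (fun u => (M < u.1.2)%N /\ u.2 = x) (@discrete_state t)).
have mE := measurable_touched k it.
apply: (le_trans (@pr_state_proper_le t S _ _ mA mE _)).
  by move=> w pt [/= ? ?]; split=> //; exact: proper_consistent.
set K := x%:R * _ / _.
have K0 : 0 <= K by rewrite divr_ge0// mulr_ge0// ltW.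
apply: (le_trans (@pr_state_le t S _
  (fun g _ _ c => (degree g (inord i) == k) && [exists l, c l == inord i])
  K t1 mE K0 _ _ _)).
- by move=> u [].
- move=> g L m w c _ gw mw cw [+ h].
  rewrite /deg -/(rgraph t w) gw => ->; rewrite eqxx /=.
  move: h; rewrite (hits_chosen t1 it mw cw) => /card_gt0P[l].
  by rewrite inE => cl; apply/existsP; exists l.
- move=> g L m [/= [/= sg L0] ML mx].
  have L0r : 0 < L%:R :> R by rewrite ltr0n.
  have w1 : \sum_v (degree g v)%:R / (2 * L)%:R = 1 :> R.
    by rewrite -mulr_suml -natr_sum sg mul2n divff// pnatr_eq0 double_eq0 -lt0n.
  have [gk|_] := eqVneq (degree g (inord i)) k; last by rewrite big_pred0.
  have w0 v : 0 <= (degree g v)%:R / (2 * L)%:R :> R by rewrite divr_ge0.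
  have := prob_hit m w0 w1 (inord i).
  move/le_trans; apply.
  rewrite gk mx /K mulrA ler_wpM2l ?mulr_ge0//.
  rewrite -(natrM _ 2) lef_pV2 ?posrE ?ltr0n ?muln_gt0//.
  by rewrite ler_nat leq_mul2l ltnW.
rewrite ler_wpM2l// pr_mono//.
- exact: discrete_event (@discrete_state t).
- by move=> w [].
Qed.

End OneStep.

(** * Sums of independent power-law variables *)

Context (alpha : R).
Hypotheses (alpha12 : 1 < alpha < 2)
  (X0_law : forall i : nat, (1 <= i)%N ->
     Q [set w | X0 w = i] = (beta alpha * i%:R `^ (- alpha))%:E).

Local Notation tail := (tail P (X 1)).
Local Notation truncated_mean := (truncated_mean P (X 1)).

Lemma X1_law n : (0 < n)%N ->
  pr [set w | X 1 w = n] = beta alpha * n%:R `^ (- alpha).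
Proof.
move=> n0; rewrite (pr_X (fun m => m = n))//.
by rewrite (_ : _ @^-1` _ = [set w | X0 w = n])// X0_law.
Qed.

Lemma pr_X1 t (S : nat -> Prop) : (1 <= t)%N ->
  pr [set w | S (X t w)] = pr [set w | S (X 1 w)].
Proof. by move=> t1; rewrite !pr_X. Qed.

Lemma pr_tail t L : (1 <= t)%N -> pr [set w | (L < X t w)%N] = tail L.
Proof. exact: (pr_X1 (fun n => L < n)%N). Qed.

Lemma discrete_sumX (r : seq nat) :
  discrete (fun w => (\sum_(i <- r) X i w)%N).
Proof.
elim: r => [|i r IH].
  under [X in discrete X]eq_fun do rewrite big_nil.
  move=> n; exact: (measurable_RV (X 0) (fun=> 0%N = n)).
under [X in discrete X]eq_fun do rewrite big_cons.
exact: (discrete_comp (fun p : nat * nat => (p.1 + p.2)%N)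
  (discrete_pair (discrete_RV (X i)) IH)).
Qed.

Lemma X_independent (s : seq nat) (S : nat -> nat -> Prop) : uniq s ->
  {subset s <= [pred t | 1 <= t]%N} ->
  pr (\big[setI/setT]_(i <- s) [set w | S i (X i w)]) =
  \prod_(i <- s) pr [set w | S i (X i w)].
Proof.
move=> us s1; have h := PARID_indep model S us s1.
apply: EFin_inj; rewrite -prE; last first.
  by apply: bigsetI_measurable => i _; exact: measurable_RV.
rewrite h -prodEFin; apply: eq_bigr => i _; rewrite -prE//.
exact: measurable_RV.
Qed.

Lemma X_indep2 i j (S S' : nat -> Prop) : (1 <= i)%N -> (1 <= j)%N ->
  i != j ->
  pr ([set w | S (X i w)] `&` [set w | S' (X j w)]) =
  pr [set w | S (X i w)] * pr [set w | S' (X j w)].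
Proof.
move=> i1 j1 ij.
have := @X_independent [:: i; j] (fun n => if n == i then S else S').
rewrite !big_cons !big_nil !setIT mulr1 eqxx [j == i]eq_sym (negbTE ij).
apply; first by rewrite /= inE ij.
by move=> n; rewrite !inE => /orP[]/eqP ->.
Qed.

Lemma X_indep3 i j l (S S' S'' : nat -> Prop) :
  (1 <= i)%N -> (1 <= j)%N -> (1 <= l)%N -> i != j -> i != l -> j != l ->
  pr ([set w | S (X i w)] `&` [set w | S' (X j w)] `&` [set w | S'' (X l w)]) =
  pr [set w | S (X i w)] * pr [set w | S' (X j w)] * pr [set w | S'' (X l w)].
Proof.
move=> i1 j1 l1 ij il jl.
have := @X_independent [:: i; j; l]
  (fun n => if n == i then S else if n == j then S' else S'').
rewrite !big_cons !big_nil !setIT mulr1 !eqxx [j == i]eq_sym (negbTE ij).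
rewrite [l == i]eq_sym (negbTE il) [l == j]eq_sym (negbTE jl) setIA mulrA.
apply; first by rewrite /= !inE negb_or ij il jl.
by move=> n; rewrite !inE => /or3P[]/eqP ->.
Qed.

(** The truncated mean and [L * tail L] together are at most
    [sum_const * L * tail L]. *)
Definition sum_const : R := 1 + 4 / (2 - alpha).
Local Notation c1 := sum_const.

Lemma sum_const_ge1 : 1 <= c1.
Proof. by move: alpha12 => /andP[_ ?]; rewrite lerDl divr_ge0//; lra. Qed.

Lemma truncated_mean_le_const L : (1 <= L)%N ->
  truncated_mean L + L%:R * tail L <= c1 * L%:R * tail L.
Proof.
move=> L1.
have := truncated_mean_le (discrete_RV (X 1)) alpha12 (pr_X_eq0 (leqnn 1)) X1_law L1.
by rewrite /sum_const; lra.
Qed.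

(** Markov's inequality for the sum of the summands truncated at [L]; the
    truncated mean and the tail contribute the same order. *)
Lemma pr_large_sum (A : set T) (r : seq nat) L : measurable A -> (1 <= L)%N ->
  {subset r <= [pred t | 1 <= t]%N} ->
  (forall i (S : nat -> Prop), i \in r ->
     pr (A `&` [set w | S (X i w)]) = pr A * pr [set w | S (X i w)]) ->
  pr (A `&` [set w | (L < \sum_(i <- r) X i w)%N]) <=
  pr A * ((size r)%:R * c1 * tail L).
Proof.
move=> mA L1 r1 indep.
have L0 : 0 < L%:R :> R by rewrite ltr0n.
pose D (p : nat * nat) := A `&` [set w | minn (X p.1 w) L.+1 = p.2].
pose c (p : nat * nat) : R := (minn p.2 L)%:R.
pose idx := [seq (i, n) | i <- r, n <- index_iota 0 L.+2].
have mD p : measurable (D p).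
  apply: measurableI => //.
  exact: (measurable_RV (X p.1) (fun n => minn n L.+1 = p.2)).
rewrite -(ler_pM2l L0).
apply: (@le_trans _ _ (\sum_(p <- idx) c p * pr (D p))).
  apply: pr_markov => //.
    apply: measurableI => //.
    exact: (discrete_event (fun n => L < n)%N (discrete_sumX r)).
  move=> w [Aw /= Lw]; rewrite big_allpairs.
  have E i : \sum_(0 <= n < L.+2) c (i, n) * \1_(D (i, n)) w =
      (minn (X i w) L)%:R.
    have iL : minn (X i w) L.+1 \in index_iota 0 L.+2.
      by rewrite mem_index_iota /= ltnS geq_minr.
    rewrite (bigD1_seq _ iL (iota_uniq _ _))/= big1 ?addr0.
      rewrite indicE mem_set// mulr1 /c/=; congr (_%:R).
      by rewrite -minnA (minn_idPr (leqnSn L)).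
    move=> n nX; rewrite indicE memNset ?mulr0// => -[_ /= e].
    by rewrite e eqxx in nX.
  under eq_bigr do rewrite E.
  rewrite -natr_sum ler_nat.
  have : (minn (\sum_(i <- r) X i w) L <= \sum_(i <- r) minn (X i w) L)%N.
    elim: {idx indep r1 Lw} r => [|i r IH]; first by rewrite !big_nil min0n.
    by rewrite !big_cons; move: IH; lia.
  by rewrite (minn_idPr (ltnW Lw)).
rewrite big_allpairs.
have E i : i \in r -> \sum_(0 <= n < L.+2) c (i, n) * pr (D (i, n)) =
    pr A * (truncated_mean L + L%:R * tail L).
  move=> ir; have i1 := r1 _ ir.
  have DE n : pr (D (i, n)) = pr A * pr [set w | minn (X 1 w) L.+1 = n].
    by rewrite /D/= (indep i (fun m => minn m L.+1 = n) ir)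
      (pr_X1 (fun m => minn m L.+1 = n) i1).
  rewrite big_nat_recr//= mulrDr mulr_sumr; congr (_ + _).
    apply: eq_big_nat => n /andP[_ nL]; rewrite DE /c/= (minn_idPl _)//.
    rewrite mulrCA; congr (_ * (_ * pr _)).
    by apply/seteqP; split=> w /=; lia.
  rewrite DE /c/= (minn_idPr (leqnSn L)) mulrCA; congr (_ * (_ * pr _)).
  by apply/seteqP; split=> w /=; lia.
rewrite (eq_big_seq _ E) big_const_seq count_predT iter_addr_0 -[leLHS]mulr_natl.
rewrite mulrCA [leRHS]mulrCA ler_wpM2l ?pr_ge0//.
have := ler_wpM2l (ler0n R (size r)) (truncated_mean_le_const L1).
by move/le_trans; apply; rewrite le_eqVlt; apply/orP; left; apply/eqP; ring.
Qed.

(** At level [L] the natural number of summands is the inverse of the tail: with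
    [N] summands the sum stays below [L] with probability 3/4, while one of them
    exceeds a given multiple of [L] with probability bounded from below. *)
Lemma critical_scale N0 : exists L N, [/\ (1 <= L)%N, (N0 <= N)%N,
  N%:R * c1 * tail L <= 4^-1 & 8^-1 <= N%:R * c1 * tail L].
Proof.
have c0 : 0 < c1 by exact: lt_le_trans sum_const_ge1.
pose eps := (4 * c1 * N0.+2%:R)^-1.
have eps0 : 0 < eps by rewrite invr_gt0 !mulr_gt0.
have [M hM] := tail_small P (discrete_RV (X 1)) eps0.
pose L := maxn M 1; have L1 : (1 <= L)%N by rewrite leq_maxr.
have tL := hM L (leq_maxl _ _).
have t0 : 0 < tail L.
  have := tail_lower (discrete_RV (X 1)) alpha12 (pr_X_eq0 (leqnn 1)) X1_law L1.
  have b0 := power_law_beta_gt0 (discrete_RV (X 1)) (pr_X_eq0 (leqnn 1)) X1_law.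
  have L0 : 0 < L%:R :> R by rewrite ltr0n.
  have : 0 < beta alpha * L%:R `^ (2 - alpha) by rewrite mulr_gt0// powR_gt0.
  by move=> /lt_le_trans h /h; rewrite pmulr_rgt0// mulr_gt0.
pose z := 4 * c1 * tail L.
have z0 : 0 < z by rewrite !mulr_gt0.
pose N := Num.truncn z^-1.
have /andP[N1 N2] : N%:R <= z^-1 < N.+1%:R.
  by apply: truncn_itv; rewrite invr_ge0 ltW.
have zN0 : N0.+2%:R <= z^-1.
  rewrite -lef_pV2 ?posrE ?invr_gt0// invrK /z mulrC -ler_pdivlMr ?mulr_gt0//.
  by rewrite -invfM mulrC.
have NN0 : (N0.+2 < N.+1)%N by rewrite -(ltr_nat R) (le_lt_trans zN0).
exists L, N; split=> //; first by clear -NN0; lia.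
  have := ler_wpM2r (ltW z0) N1; rewrite mulVf ?gt_eqF// /z; lra.
have := N2; rewrite -(ltr_pM2r z0) mulVf ?gt_eqF// -natr1 /z => h.
have N1' : 1 <= N%:R :> R by rewrite ler1n; clear -NN0; lia.
have : 0 <= c1 * tail L by rewrite mulr_ge0// ltW.
by nra.
Qed.

Lemma tail_multiple L N m : (1 <= m)%N -> (1 <= N)%N ->
  8^-1 <= N%:R * c1 * tail L ->
  (8 * c1 * m%:R `^ alpha)^-1 <= N%:R * tail (m * L).
Proof.
move=> m1 N1 h; have c0 : 0 < c1 by exact: lt_le_trans sum_const_ge1.
have m0 : 0 < m%:R `^ alpha :> R by rewrite powR_gt0// ltr0n.
have := tail_scale (discrete_RV (X 1)) X1_law L m1.
move=> /(ler_wpM2l (ler0n R N)) h2.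
rewrite -[leLHS]mul1r ler_pdivrMr ?mulr_gt0//.
have : N%:R * tail L * (8 * c1) <= N%:R * (m%:R `^ alpha * tail (m * L)) * (8 * c1).
  by rewrite ler_wpM2r// mulr_ge0// ltW.
by lra.
Qed.

(** * The two obstructions to convergence *)

Local Notation r_ := (Defs.r_ X C).

Lemma measurable_r_ k N (S : R -> Prop) : measurable [set w | S (r_ k N w)].
Proof.
exact: (measurable_rgraph (fun g => S ((num_degree g k)%:R / N.+1%:R))).
Qed.

Lemma cvg_in_probability_pr k a (eps e : R) :
  cvg_in_probability P (r_ k) a -> 0 < eps -> 0 < e ->
  exists N0, forall N, (N0 <= N)%N -> pr [set w | eps <= `|r_ k N w - a|] <= e.
Proof.
move=> cvg eps0 e0.
have /fine_cvgP[_ /cvgrPdist_le /(_ _ e0)[N0 _ h]] := cvg _ eps0.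
by exists N0 => N /h; rewrite /= sub0r normrN ger0_norm// fine_ge0.
Qed.

Lemma r_indic k N w :
  r_ k N w * N.+1%:R = \sum_(0 <= i < N.+1) \1_[set w | rdeg N w i = k] w.
Proof.
rewrite /Defs.r_ divfK ?pnatr_eq0// /R_ num_degree_sum natr_sum big_mkord.
apply: eq_bigr => i _; rewrite deg_inord indicE.
by case: eqP => e; [rewrite mem_set|rewrite memNset].
Qed.

Lemma measurable_rdeg_eq N i k : measurable [set w | rdeg N w i = k].
Proof. exact: (measurable_rdeg N i (fun n => n = k)). Qed.

Definition others (N : nat) (s : seq nat) : seq nat :=
  [seq u <- index_iota 1 N.+1 | u \notin s].

Lemma mem_others N s u :
  (u \in others N s) = [&& u \notin s, 1 <= u & u <= N]%N.
Proof. by rewrite mem_filter mem_index_iota ltnS. Qed.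

Lemma size_others N s : (size (others N s) <= N)%N.
Proof. by rewrite size_filter (leq_trans (count_size _ _))// size_iota subn1. Qed.

Lemma others_ge N s u w : u \notin s -> (1 <= u)%N -> (u <= N)%N ->
  (X u w <= \sum_(i <- others N s) X i w)%N.
Proof.
move=> us u1 uN; rewrite (big_rem u)/= ?leq_addr//.
by rewrite mem_others us u1 uN.
Qed.

Lemma Lambda_le_others N s t w : (t <= N)%N ->
  (forall u, u \in s -> (t < u)%N) ->
  (rLambda t w <= \sum_(i <- others N s) X i w)%N.
Proof.
move=> tN st; rewrite big_filter /Defs.rLambda /Lambda.
rewrite [leqRHS](big_cat_nat (n := t.+1))//=; apply: leq_trans (leq_addr _ _).
rewrite [leqRHS]big_nat_cond [leqLHS]big_nat_cond.
rewrite [leqRHS](eq_bigl (fun i => (1 <= i < t.+1)%N && true))// => i.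
case: (boolP (0 < i < t.+1)%N) => //= /andP[_ it].
by apply/negP => /st; rewrite ltnNge -ltnS it.
Qed.

(** In combination with a jump beyond [L] in a step of [s], this says that the
    jump outweighs all other steps up to step [N] together. *)
Definition calm (N L : nat) (s : seq nat) : set T :=
  [set w | (\sum_(i <- others N s) X i w <= L)%N].

Lemma measurable_calm N L s : measurable (calm N L s).
Proof. exact: (discrete_event (fun n => n <= L)%N (discrete_sumX (others N s))). Qed.

(** At the critical scale the other steps are harmless with conditional
    probability at least 3/4. *)
Lemma pr_calm (A : set T) N L s : measurable A -> (1 <= L)%N ->
  N%:R * c1 * tail L <= 4^-1 ->
  (forall i (S : nat -> Prop), (1 <= i)%N -> i \notin s ->
     pr (A `&` [set w | S (X i w)]) = pr A * pr [set w | S (X i w)]) ->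
  3 / 4 * pr A <= pr (A `&` calm N L s).
Proof.
move=> mA L1 NL indep; have c0 : 0 < c1 by exact: lt_le_trans sum_const_ge1.
have := pr_setD P mA (measurable_calm N L s).
have -> : A `&` ~` calm N L s =
    A `&` [set w | (L < \sum_(i <- others N s) X i w)%N].
  by congr (_ `&` _); apply/seteqP; split=> w /=; rewrite /calm /= ltnNge => /negP.
have : pr (A `&` [set w | (L < \sum_(i <- others N s) X i w)%N]) <= pr A * 4^-1.
  apply: le_trans (@pr_large_sum A (others N s) L mA L1 _ _) _.
  - by move=> i; rewrite mem_others => /and3P[].
  - by move=> i S; rewrite mem_others => /and3P[is1 i1 _]; exact: indep.
  rewrite ler_wpM2l ?pr_ge0// (le_trans _ NL)// ler_wpM2r ?tail_ge0//.
  by rewrite ler_wpM2r ?(ltW c0)// ler_nat size_others.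
by lra.
Qed.

(** If one of the last steps brings far more edges than all others together,
    then the vertices older than this step have large degrees, and the younger
    ones are few. The events [H s] that step [s] is of this kind are disjoint,
    and by Markov's inequality the ratio is far from [a] on at least a quarter
    of each; summed over the window they keep this probability away from 0. *)
Lemma not_cvg_pos k (a : R) : 0 < a <= 1 -> ~ cvg_in_probability P (r_ k) a.
Proof.
move=> /andP[a0 a1] cvg.
have c0 : 0 < c1 by exact: lt_le_trans sum_const_ge1.
(* the window is a fraction [1 / q <= a / 8] of all steps *)
pose q := (Num.truncn (8 / a)).+1.
have q8 : 8 / a < q%:R.
  by have /andP[] := truncn_itv (ltac:(by rewrite divr_ge0// ltW) : 0 <= 8 / a).
have q0 : 0 < q%:R :> R by rewrite ltr0n.
have q2 : (2 <= q)%N.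
  rewrite -(ler_nat R) (le_trans _ (ltW q8))// ler_pdivlMr//; lra.
(* the jump is so large that Chernoff's bound [delta] below is at most [a / 8] *)
pose m := (Num.truncn (2 ^+ k * 32 / a)).+1.
have m32 : 2 ^+ k * 32 / a < m%:R.
  by have /andP[] := truncn_itv
    (ltac:(by rewrite divr_ge0 ?mulr_ge0 ?exprn_ge0// ltW) : 0 <= 2 ^+ k * 32 / a).
have m1 : (1 <= m)%N by [].
pose cm := (8 * c1 * m%:R `^ alpha)^-1.
have cm0 : 0 < cm by rewrite invr_gt0 !mulr_gt0// powR_gt0// ltr0n.
have e0 : 0 < cm / (16 * q%:R) by rewrite divr_gt0// mulr_gt0.
have a20 : 0 < a / 2 by rewrite divr_gt0.
have [N0 hN0] := cvg_in_probability_pr cvg a20 e0.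
have [L [N [L1 NN0 NL NL']]] := critical_scale (maxn N0 (2 * q)).
have {hN0} /hN0 prB : (N0 <= N)%N by rewrite (leq_trans _ NN0)// leq_maxl.
have Nq : (2 * q <= N)%N by rewrite (leq_trans _ NN0)// leq_maxr.
have N1 : (1 <= N)%N by clear -Nq; lia.
have Ntail := tail_multiple m1 N1 NL'; rewrite -/cm in Ntail.
pose W := (N %/ q)%N.
have WN : W%:R <= a / 8 * N%:R.
  have : (W * q)%:R <= N%:R :> R by rewrite ler_nat leq_divM.
  rewrite natrM => WqN; rewrite -(ler_pM2r q0) (le_trans WqN)//.
  have : 8 < q%:R * a by rewrite -ltr_pdivrMr.
  by have : 0 <= N%:R :> R by []; nra.
have NW : N%:R <= 2 * q%:R * W%:R :> R.
  rewrite -!natrM ler_nat /W.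
  have := divn_eq N q; have := ltn_pmod N (isT : (0 < q)%N).
  have : (2 <= N %/ q)%N by rewrite leq_divRL.
  by clear; nia.
have WN2 : (W < N)%N.
  have := leq_divM N q; have : (2 <= N %/ q)%N by rewrite leq_divRL.
  by rewrite /W; clear -q2; nia.
pose t := tail (m * L).
have t0 : 0 <= t by exact: tail_ge0.
pose H s := [set w | (m * L < X s w)%N] `&` calm N L [:: s].
have mH s : measurable (H s).
  apply: measurableI (measurable_calm _ _ _).
  exact: (measurable_RV (X s) (fun n => m * L < n)%N).
have prH s : (1 <= s)%N -> 3 / 4 * t <= pr (H s).
  move=> s1; rewrite -[t](pr_tail _ s1); apply: pr_calm => //.
    exact: (measurable_RV (X s) (fun n => m * L < n)%N).
  move=> i S i1; rewrite inE => si.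
  by rewrite (X_indep2 (fun n => m * L < n)%N) // eq_sym.
pose B := [set w | a / 2 <= `|r_ k N w - a|].
have mB : measurable B by exact: (measurable_r_ k N (fun x => a / 2 <= `|x - a|)).
pose delta : R := 2 ^+ k * (1 - (4 * L%:R)^-1) ^+ (m * L).
have L0 : 0 < L%:R :> R by rewrite ltr0n.
have delta_le : delta <= a / 8.
  set y : R := (4 * L%:R)^-1.
  have y0 : 0 < y by rewrite invr_gt0 mulr_gt0.
  have y1 : y <= 1.
    by rewrite invf_le1 ?mulr_gt0//; have : 1 <= L%:R :> R; [rewrite ler1n|lra].
  (* [(1 - y) ^ n <= 1 / (1 + n * y)], because [(1 - y) * (1 + y) <= 1] *)
  have h : (1 - y) ^+ (m * L) * (1 + m%:R / 4) <= 1.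
    have -> : m%:R / 4 = (m * L)%:R * y :> R.
      by rewrite natrM /y invfM mulrACA divff ?gt_eqF// mulr1.
    apply: (@le_trans _ _ ((1 - y) ^+ (m * L) * (1 + y) ^+ (m * L))).
      rewrite ler_wpM2l ?exprn_ge0 ?subr_ge0//.
      elim: (m * L)%N => [|n IH]; first by rewrite mul0r addr0 expr0.
      rewrite exprS -natr1.
      have : (1 + y) * (1 + n%:R * y) <= (1 + y) * (1 + y) ^+ n.
        by rewrite ler_wpM2l// addr_ge0// ltW.
      have : 0 <= n%:R * y * y by rewrite !mulr_ge0// ltW.
      by lra.
    rewrite -exprMn exprn_ile1//; last by nra.
    by rewrite mulr_ge0//; lra.
  have k0 : 0 < 2 ^+ k :> R by rewrite exprn_gt0.
  have p0 : 0 <= (1 - y) ^+ (m * L) by rewrite exprn_ge0// subr_ge0.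
  have m0 : 0 < m%:R :> R by rewrite ltr0n.
  have : 2 ^+ k * 32 < m%:R * a by rewrite -ltr_pdivrMr.
  rewrite /delta; set p := (_ ^+ (m * L)) in h p0 *.
  have : p * m%:R <= 4 by lra.
  move=> pm ka.
  have : 2 ^+ k * 32 * p <= m%:R * a * p by rewrite ler_wpM2r// ltW.
  have : p * m%:R * a <= 4 * a by rewrite ler_wpM2r// ltW.
  by lra.
have few s : (N - W < s)%N -> (s <= N)%N -> pr (H s `&` ~` B) <= t / 2.
  move=> Ws sN.
  case: s Ws sN => // s Ws sN.
  have s1 : (1 <= s)%N by clear -Ws WN2; lia.
  have mD i : measurable (H s.+1 `&` [set w | rdeg N w i = k]).
    by apply: measurableI => //; exact: measurable_rdeg_eq.
  have N10 : 0 < N.+1%:R :> R by rewrite ltr0n.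
  have aN : 0 <= a / 2 * N.+1%:R by rewrite mulr_ge0// ltW.
  have mHB : measurable (H s.+1 `&` ~` B) by apply: measurableI => //; exact: measurableC.
  have : a / 2 * N.+1%:R * pr (H s.+1 `&` ~` B) <=
      \sum_(0 <= i < N.+1) 1 * pr (H s.+1 `&` [set w | rdeg N w i = k]).
    apply: pr_markov => // w [Hw Bw].
    under eq_bigr do rewrite mul1r indicI /= indicE (mem_set Hw) mul1r.
    rewrite -r_indic ler_wpM2r// leNgt; apply/negP => r_lt.
    apply: Bw; rewrite /B /= ler0_norm; lra.
  under eq_bigr do rewrite mul1r.
  rewrite (big_cat_nat (n := s.+1))//=; last by rewrite ltnS ltnW.
  have young : \sum_(s.+1 <= i < N.+1) pr (H s.+1 `&` [set w | rdeg N w i = k])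
      <= W%:R * t.
    apply: (@le_trans _ _ (\sum_(s.+1 <= i < N.+1) t)).
      apply: ler_sum => i _; rewrite -[t](pr_tail (m * L) (isT : (1 <= s.+1)%N)).
      apply: pr_mono => //; first exact: (measurable_RV (X s.+1) (fun n => m * L < n)%N).
      by move=> w [[]].
    rewrite sumr_const_nat -[leLHS]mulr_natl ler_wpM2r// ler_nat.
    by clear -Ws; lia.
  have old : \sum_(0 <= i < s.+1) pr (H s.+1 `&` [set w | rdeg N w i = k])
      <= N.+1%:R * (delta * t).
    apply: (@le_trans _ _ (\sum_(0 <= i < s.+1) (delta * t))).
      apply: ler_sum_nat => i /andP[_ si].
      rewrite -[t](pr_tail (m * L) (isT : (1 <= s.+1)%N)).
      apply: le_trans (@pr_small_degree s i k L (m * L) s1 _ L1) => //.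
      apply: pr_mono => //.
        apply: measurableI; last exact: (measurable_rdeg s.+1 i (fun n => n <= k)%N).
        exact: (discrete_event (fun u => (u.1.2 <= L)%N /\ (m * L < u.2)%N)
          (@discrete_state s)).
      move=> w [[/= Xs cs]] <-; split; last exact: deg_mono (ltnW si) sN.
      split=> //; apply: leq_trans cs; apply: Lambda_le_others (ltnW sN) _.
      by move=> u; rewrite inE => /eqP ->.
    rewrite sumr_const_nat subn0 -[leLHS]mulr_natl ler_wpM2r ?ler_nat// 1?ltnW//.
    rewrite mulr_ge0// /delta mulr_ge0 ?exprn_ge0// subr_ge0 invf_le1 ?mulr_gt0//.
    by have : 1 <= L%:R :> R; [rewrite ler1n|lra].
  have N10' : N%:R <= N.+1%:R :> R by rewrite ler_nat.
  have dN : N.+1%:R * (delta * t) <= N.+1%:R * (a / 8 * t).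
    by rewrite ler_wpM2l// ler_wpM2r.
  have WNt : W%:R * t <= a / 8 * N.+1%:R * t.
    by rewrite ler_wpM2r// (le_trans WN)// ler_wpM2l// divr_ge0// ltW.
  set p := pr _; move=> h.
  have h' : a * N.+1%:R / 2 * p <= a * N.+1%:R / 2 * (t / 2) by lra.
  by move: h'; rewrite ler_pM2l// !mulr_gt0// invr_gt0.
have many s : (N - W < s)%N -> (s <= N)%N -> t / 4 <= pr (H s `&` B).
  move=> Ws sN; have := few _ Ws sN; have := pr_setD P (mH s) mB.
  have s1 : (1 <= s)%N by clear -Ws; lia.
  by have := prH s s1; lra.
have : \sum_((N - W).+1 <= s < N.+1) pr (H s `&` B) <= pr B.
  apply: pr_disjoint => //; first exact: iota_uniq.
  - by move=> s; exact: measurableI.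
  - by move=> s w _ [].
  - move=> s s' w; rewrite !mem_index_iota => /andP[Ws sN] _.
    move=> [[/= Xs _] _] [[_ cs'] _]; apply/eqP/negPn/negP => ss'.
    have s_other : s \notin [:: s'] by rewrite inE.
    have s1 : (1 <= s)%N by exact: leq_ltn_trans Ws.
    have := leq_trans Xs (leq_trans (others_ge w s_other s1 sN) cs').
    by rewrite ltnNge leq_pmull.
have : W%:R * (t / 4) <= \sum_((N - W).+1 <= s < N.+1) pr (H s `&` B).
  rewrite mulr_natl -[X in _ *+ X](_ : N.+1 - (N - W).+1 = W)%N.
    by rewrite -sumr_const_nat; apply: ler_sum_nat => s /andP[Ws sN]; exact: many.
  by clear -WN2; lia.
move=> h1 h2.
have h3 : W%:R * (t / 4) <= cm / (16 * q%:R).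
  by rewrite (le_trans h1)// (le_trans h2).
have h4 : N%:R * t <= 2 * q%:R * W%:R * t by rewrite ler_wpM2r.
move: h3; rewrite ler_pdivlMr ?mulr_gt0// => h3.
by move: Ntail cm0; rewrite -/t; lra.
Qed.

(** Given [X v.+1 = x], the bound of [pr_hit] is proportional to [x]; as [X v.+1]
    is independent of [Lambda v], summing over [x <= L] yields the truncated
    mean. The second factor is the probability that [Lambda v] is large, which
    is what makes the bound small against the probability of a jump. *)
Lemma pr_touched v s k m L N : (1 <= v)%N -> (v <= N)%N -> (s <= v)%N ->
  (1 <= m)%N -> (1 <= L)%N ->
  pr ([set w | (m * L < rLambda v w)%N /\ (X v.+1 w <= L)%N] `&` touched v s k)
  <= k%:R / (2 * m%:R) * (c1 * tail L) * (N%:R * c1 * tail (m * L)).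
Proof.
move=> v1 vN sv m1 L1.
have c0 : 0 < c1 by exact: lt_le_trans sum_const_ge1.
have L0 : 0 < L%:R :> R by rewrite ltr0n.
have m0 : 0 < m%:R :> R by rewrite ltr0n.
have mL1 : (1 <= m * L)%N by rewrite muln_gt0 m1.
pose D x := [set w | (m * L < rLambda v w)%N /\ X v.+1 w = x].
have mEv (S : nat -> nat -> Prop) : measurable [set w | S (rLambda v w) (X v.+1 w)].
  exact: (discrete_event (fun u => S u.1.2 u.2) (@discrete_state v)).
have mD x : measurable (D x).
  exact: (mEv (fun a b => (m * L < a)%N /\ b = x)).
have mX x : measurable [set w | X v.+1 w = x].
  exact: (measurable_RV (X v.+1) (fun n => n = x)).
have prD x : pr (D x) <=
    pr [set w | X 1 w = x] * (N%:R * c1 * tail (m * L)).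
  have -> : D x = [set w | X v.+1 w = x] `&`
      [set w | (m * L < \sum_(i <- index_iota 1 v.+1) X i w)%N].
    by apply/seteqP; split=> w /= [].
  rewrite -(pr_X1 (fun n => n = x) (isT : (1 <= v.+1)%N)).
  apply: le_trans (@pr_large_sum _ _ _ (mX x) mL1 _ _) _.
  - by move=> i; rewrite mem_index_iota => /andP[].
  - move=> i S; rewrite mem_index_iota ltnS => /andP[i1 iv].
    rewrite (X_indep2 (fun n => n = x))//.
    by rewrite neq_ltn ltnS iv orbT.
  - rewrite size_iota subn1 ler_wpM2l ?pr_ge0// ler_wpM2r ?tail_ge0//.
    by rewrite ler_wpM2r ?(ltW c0)// ler_nat.
apply: (@le_trans _ _ (\sum_(0 <= x < L.+1) pr (D x `&` touched v s k))).
  apply: pr_cover.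
  - apply: measurableI (measurable_touched _ sv).
    exact: (mEv (fun a b => (m * L < a)%N /\ (b <= L)%N)).
  - by move=> x; apply: measurableI (measurable_touched _ sv).
  - move=> w [[/= Lw XL] tw]; exists (X v.+1 w); first by rewrite mem_index_iota.
    by [].
set Z := N%:R * c1 * tail (m * L) in prD *.
have Z0 : 0 <= Z by rewrite mulr_ge0 ?tail_ge0// mulr_ge0// ltW.
have K0 : 0 <= k%:R / (2 * (m * L)%:R) :> R by rewrite divr_ge0.
apply: (@le_trans _ _ (k%:R / (2 * (m * L)%:R) * truncated_mean L * Z)).
  rewrite /truncated_mean mulr_sumr mulr_suml; apply: ler_sum_nat => x _.
  apply: le_trans (pr_hit k x v1 sv mL1) _.
  rewrite [x%:R * k%:R]mulrC -!mulrA ler_wpM2l//.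
  rewrite [leLHS]mulrCA ler_wpM2l ?invr_ge0//.
  by rewrite ler_wpM2l//; exact: prD.
rewrite ler_wpM2r//.
have tm : truncated_mean L <= c1 * L%:R * tail L.
  have := truncated_mean_le_const L1.
  by have : 0 <= L%:R * tail L; [rewrite mulr_ge0 ?tail_ge0|lra].
apply: le_trans (ler_wpM2l K0 tm) _.
rewrite le_eqVlt; apply/orP; left; apply/eqP; rewrite natrM; field.
by rewrite !gt_eqF.
Qed.

(** If one of the steps up to [h] outweighs everything else, then most edge
    ends of the later steps go to vertices that profited from it, and a younger
    vertex that comes with [k] edges is rarely chosen. Hence each vertex of the
    second half has degree [k] at the end with probability bounded from below,
    and the mean of the ratio does not tend to 0. *)
Lemma not_cvg0 k : (1 <= k)%N -> ~ cvg_in_probability P (r_ k) 0.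
Proof.
move=> k1 cvg.
have c0 : 0 < c1 by exact: lt_le_trans sum_const_ge1.
pose qk := pr [set w | X 1 w = k].
have qk0 : 0 < qk.
  rewrite /qk X1_law// mulr_gt0 ?powR_gt0 ?ltr0n//.
  exact: (power_law_beta_gt0 (discrete_RV (X 1)) (pr_X_eq0 (leqnn 1)) X1_law).
(* this multiple makes [loss] at most half of [gain] below *)
pose m := (Num.truncn (k%:R * c1 / qk)).+1.
have mk : k%:R * c1 / qk < m%:R.
  by have /andP[] := truncn_itv
    (ltac:(by rewrite divr_ge0 ?mulr_ge0// ltW) : 0 <= k%:R * c1 / qk).
have m1 : (1 <= m)%N by [].
have m0 : 0 < m%:R :> R by rewrite ltr0n.
pose cm := (8 * c1 * m%:R `^ alpha)^-1.
have cm0 : 0 < cm by rewrite invr_gt0 !mulr_gt0// powR_gt0// ltr0n.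
pose eta := qk * cm / 128.
have eta0 : 0 < eta by rewrite divr_gt0// mulr_gt0.
have [N0 hN0] := cvg_in_probability_pr cvg eta0 eta0.
have [L [N [L1 NN0 NL NL']]] := critical_scale (maxn N0 2).
have {hN0} /hN0 prB : (N0 <= N)%N by rewrite (leq_trans _ NN0)// leq_maxl.
have N2 : (2 <= N)%N by rewrite (leq_trans _ NN0)// leq_maxr.
have N1 : (1 <= N)%N by exact: ltnW.
have Ntail := tail_multiple m1 N1 NL'; rewrite -/cm in Ntail.
pose t := tail (m * L).
have t0 : 0 <= t by exact: tail_ge0.
pose h := N./2.
have hN : (h < N)%N by rewrite /h; clear -N2; lia.
have h3 : N%:R <= 3 * h%:R :> R by rewrite -natrM ler_nat /h; clear -N2; lia.
have Nh : N%:R <= 2 * (N - h)%:R :> R.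
  by rewrite -natrM ler_nat /h; clear -N2; lia.
pose bigX u := [set w | (m * L < X u w)%N].
pose isk s := [set w | X s w = k].
have mbigX u : measurable (bigX u).
  exact: (measurable_RV (X u) (fun n => m * L < n)%N).
have misk s : measurable (isk s) by exact: (measurable_RV (X s) (fun n => n = k)).
pose E u s := bigX u `&` isk s `&` calm N L [:: u; s].
have mA u s : measurable (bigX u `&` isk s) by exact: measurableI.
have mE u s : measurable (E u s) by apply: measurableI (measurable_calm _ _ _).
have prE u s : (1 <= u)%N -> (u < s)%N -> 3 / 4 * (t * qk) <= pr (E u s).
  move=> u1 us; have s1 : (1 <= s)%N by exact: leq_trans us.
  have us' : u != s by rewrite neq_ltn us.
  have tq : pr (bigX u `&` isk s) = t * qk.
    rewrite (X_indep2 (fun n => m * L < n)%N (fun n => n = k))//.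
    by rewrite pr_tail// (pr_X1 (fun n => n = k)).
  rewrite -tq; apply: pr_calm => // i S i1.
  rewrite !inE negb_or => /andP[iu is_].
  rewrite (X_indep3 (fun n => m * L < n)%N (fun n => n = k)) ?[_ == i]eq_sym//.
  by rewrite (X_indep2 (fun n => m * L < n)%N (fun n => n = k)).
pose G s := [set w | rdeg N w s = k].
have mG s : measurable (G s) by exact: measurable_rdeg_eq.
pose hit s v := [set w | (m * L < rLambda v w)%N /\ (X v.+1 w <= L)%N] `&`
  touched v s k.
have mhit s v : (s <= v)%N -> measurable (hit s v).
  move=> sv; apply: measurableI (measurable_touched _ sv).
  exact: (discrete_event (fun u => (m * L < u.1.2)%N /\ (u.2 <= L)%N)
    (@discrete_state v)).
have prG s : (h < s)%N -> (s <= N)%N -> 8^-1 * (N%:R * t * qk) <= pr (G s).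
  move=> hs sN.
  pose hits_s := \big[setU/set0]_(v <- index_iota s N) hit s v.
  have mhits : measurable hits_s.
    rewrite /hits_s big_seq; apply: bigsetU_measurable => v.
    by rewrite mem_index_iota => /andP[sv _]; exact: mhit.
  have mnp : measurable (~` [set w | rproper N w]).
    exact: measurableC (measurable_proper _).
  have s1 : (1 <= s)%N by exact: leq_ltn_trans hs.
  have gain : \sum_(1 <= u < h.+1) pr (E u s) <=
      pr (G s `|` (~` [set w | rproper N w] `|` hits_s)).
    apply: pr_disjoint => //; first exact: iota_uniq.
    - by do 2 (apply: measurableU => //).
    - move=> u w; rewrite mem_index_iota ltnS => /andP[u1 uh].
      move=> [[/= Xu Xs] cw].
      have us : (u < s)%N by exact: leq_ltn_trans hs.
      have [dk|dk] := eqVneq (rdeg N w s) k; [by left|right].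
      have [pN|] := pselect (rproper N w); [right|by left].
      have ds : rdeg s w s = k.
        by rewrite deg_new//; exact: proper_le pN.
      have [v [sv vN dv hv]] := degree_change sN ds dk.
      rewrite /hits_s -bigcup_seq; exists v; first by rewrite /= mem_index_iota sv.
      split=> //; split.
        apply: leq_trans Xu _; rewrite /Defs.rLambda /Lambda.
        rewrite (big_rem u)/= ?leq_addr// mem_index_iota u1 ltnS.
        exact: leq_trans (ltnW us) sv.
      apply: leq_trans cw; apply: others_ge => //.
      rewrite !inE negb_or !neq_ltn !ltnS sv orbT andbT.
      by rewrite (leq_trans (ltnW us) sv) orbT.
    - move=> u u' w; rewrite !mem_index_iota !ltnS => /andP[u1 uh] /andP[u'1 u'h].
      move=> [[/= Xu _] _] [_ cw]; apply/eqP/negPn/negP => uu'.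
      have u_other : u \notin [:: u'; s].
        by rewrite !inE negb_or uu' neq_ltn (leq_ltn_trans uh hs).
      have uN : (u <= N)%N by rewrite (leq_trans uh)// ltnW.
      have := leq_trans Xu (leq_trans (others_ge w u_other u1 uN) cw).
      by rewrite ltnNge leq_pmull.
  have loss : pr hits_s <= N%:R * (k%:R / (2 * m%:R) * (c1 * tail L) * (N%:R * c1 * t)).
    pose hit' v := if (s <= v)%N then hit s v else set0.
    have mhit' v : measurable (hit' v).
      by rewrite /hit'; case: ifP => // sv; exact: mhit.
    apply: (@le_trans _ _ (\sum_(s <= v < N) pr (hit' v))).
      apply: pr_cover => // w; rewrite /hits_s -bigcup_seq => -[v /= vi hw].
      exists v => //; rewrite /hit'; move: vi; rewrite mem_index_iota => /andP[-> _].
      by [].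
    set K := k%:R / _ * _ * _.
    have K0 : 0 <= K.
      by rewrite !mulr_ge0 ?divr_ge0 ?tail_ge0 ?mulr_ge0// ltW.
    apply: (@le_trans _ _ (\sum_(s <= v < N) K)).
      apply: ler_sum_nat => v /andP[sv vN]; rewrite /hit' sv.
      by apply: pr_touched => //; [exact: leq_trans sv|exact: ltnW].
    rewrite sumr_const_nat -[leLHS]mulr_natl ler_wpM2r// ler_nat.
    exact: leq_subr.
  have split_le : pr (G s `|` (~` [set w | rproper N w] `|` hits_s)) <=
      pr (G s) + pr hits_s.
    apply: le_trans (@pr_le2 _ _ _ P _ (G s)
      (~` [set w | rproper N w] `|` hits_s) _ _ _ _) _ => //.
    - by do 2 (apply: measurableU => //).
    - exact: measurableU.
    rewrite lerD2l -[leRHS]add0r -(pr_proper N).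
    by apply: pr_le2 => //; exact: measurableU.
  have gain2 : h%:R * (3 / 4 * (t * qk)) <= \sum_(1 <= u < h.+1) pr (E u s).
    rewrite mulr_natl -[X in _ *+ X](subn1 h.+1) -sumr_const_nat.
    apply: ler_sum_nat => u /andP[u1 uh]; apply: prE => //.
    exact: leq_trans uh hs.
  have tq0 : 0 <= t * qk by rewrite mulr_ge0// ltW.
  have h3' : N%:R * (t * qk) <= 3 * h%:R * (t * qk) by rewrite ler_wpM2r.
  have kmq : k%:R / m%:R * c1 <= qk.
    by rewrite mulrAC ler_pdivrMr// [leRHS]mulrC -ler_pdivrMr// ltW.
  have loss2 : pr hits_s <= 8^-1 * (N%:R * t * qk).
    apply: (le_trans loss).
    have -> : N%:R * (k%:R / (2 * m%:R) * (c1 * tail L) * (N%:R * c1 * t)) =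
        (N%:R * c1 * tail L) * ((k%:R / m%:R * c1) * (N%:R * t) / 2).
      by field; rewrite gt_eqF.
    apply: (@le_trans _ _ (4^-1 * (qk * (N%:R * t) / 2))); last by lra.
    apply: ler_pM => //.
    - by rewrite mulr_ge0 ?tail_ge0// mulr_ge0// ltW.
    - by rewrite !mulr_ge0// ?divr_ge0// ?invr_ge0// ltW.
    - by rewrite ler_wpM2r ?invr_ge0// ler_wpM2r// mulr_ge0.
  by lra.
pose B := [set w | eta <= `|r_ k N w - 0|].
have mB : measurable B by exact: (measurable_r_ k N (fun x => eta <= `|x - 0|)).
have N10 : 0 < N.+1%:R :> R by rewrite ltr0n.
have r0 w : 0 <= r_ k N w by rewrite divr_ge0.
(* [E r_k <= eta + P (r_k >= eta)] *)
have mean_le : \sum_(h.+1 <= s < N.+1) pr (G s) <= N.+1%:R * eta + N.+1%:R * pr B.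
  pose e (b : bool) : R := if b then N.+1%:R * eta else N.+1%:R.
  pose D (b : bool) := if b then setT else B.
  have -> : N.+1%:R * eta + N.+1%:R * pr B =
      \sum_(b <- [:: true; false]) e b * pr (D b).
    by rewrite !big_cons big_nil addr0 /e /D prT mulr1.
  apply: (@le_trans _ _ (\sum_(0 <= s < N.+1) 1 * pr (G s))).
    rewrite [leRHS](big_cat_nat (n := h.+1))//= ?ltnS ?(ltnW hN)//.
    rewrite -[leLHS]add0r lerD//.
      by apply: sumr_ge0 => i _; rewrite mul1r pr_ge0.
    by apply: ler_sum => i _; rewrite mul1r.
  apply: pr_weighted_le => //.
  - by case; rewrite /e// mulr_ge0// ltW.
  - by case; rewrite /D.
  - move=> w; rewrite [leRHS]big_cons [X in _ <= _ + X]big_seq1 /e /D indicT mulr1.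
    under eq_bigr do rewrite mul1r.
    have -> : \sum_(0 <= i < N.+1) \1_(G i) w = r_ k N w * N.+1%:R.
      by rewrite r_indic.
    rewrite mulrC -mulrDr ler_wpM2l ?(ltW N10)//.
    have rle1 : r_ k N w <= 1.
      rewrite /Defs.r_ ler_pdivrMr// mul1r ler_nat.
      by rewrite (leq_trans (max_card _))// card_ord.
    rewrite indicE; have [_|] := boolP (w \in B).
      by rewrite (le_trans rle1)// lerDr ltW.
    rewrite notin_setE /B /= subr0 ger0_norm// addr0 => /negP.
    by rewrite -ltNge => /ltW.
have mean_ge : (N - h)%:R * (8^-1 * (N%:R * t * qk)) <=
    \sum_(h.+1 <= s < N.+1) pr (G s).
  rewrite mulr_natl -[X in _ *+ X](subSS h N) -sumr_const_nat.
  by apply: ler_sum_nat => s /andP[hs sN]; exact: prG.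
have tq0 : 0 <= N%:R * t * qk by rewrite !mulr_ge0// ltW.
have low : cm * qk <= N%:R * t * qk by rewrite ler_wpM2r// ltW.
have e1 : (N - h)%:R * (8^-1 * (cm * qk)) <= (N - h)%:R * (8^-1 * (N%:R * t * qk)).
  by rewrite ler_wpM2l//; lra.
have e2 : N%:R * (cm * qk) <= 2 * (N - h)%:R * (cm * qk).
  by rewrite ler_wpM2r// mulr_ge0// ltW.
have e3 : N.+1%:R * pr B <= N.+1%:R * eta by rewrite ler_wpM2l// ltW.
have e4 : N.+1%:R * (cm * qk) <= 2 * N%:R * (cm * qk).
  rewrite ler_wpM2r ?mulr_ge0 ?(ltW cm0) ?(ltW qk0)//.
  by rewrite -natrM ler_nat; clear -N1; lia.
have e5 : 0 < N.+1%:R * (cm * qk) by rewrite !mulr_gt0.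
have etaE : N.+1%:R * eta = N.+1%:R * (cm * qk) / 128 by rewrite /eta; ring.
rewrite etaE in e3 mean_le.
by lra.
Qed.

End Model.

Unset Implicit Arguments.
Set Strict Implicit.
Set Printing Implicit Defensive.

Theorem theorem2p1 (R : realType) (alpha : R) (halpha : 1 < alpha < 2)
  (d' : measure_display) (T' : measurableType d') (Q : probability T' R)
  (X0 : {RV Q >-> nat}) (X0_pos : forall w : T', (1 <= X0 w)%N)
  (X0_law : forall i : nat, (1 <= i)%N ->
     Q [set w | X0 w = i] = (beta alpha * i%:R `^ (- alpha))%:E)
  (d : measure_display) (T : measurableType d) (P : probability T R)
  (X : nat -> {RV P >-> nat}) (C : nat -> nat -> {RV P >-> nat})
  (model : PARID X C X0)
  (k : nat) (hk : (1 <= k)%N) :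
  ~ (exists a : R, 0 <= a <= 1 /\ cvg_in_probability P (r_ X C k) a).
Proof.
move=> [a [/andP[+ a1] cvg]]; rewrite le_eqVlt => /predU1P[a0|a0].
  by apply: (not_cvg0 model X0_pos halpha X0_law hk); rewrite a0.
by apply: (not_cvg_pos model X0_pos halpha X0_law _ cvg); rewrite a0.
Qed.
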